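(* Let $\mathfrak{O}$ be the valuation ring of a non-Archimedean local field $K$, let $q$ be the residue field size of $\mathfrak{O}$, and let $|\cdot|$ be the absolute value on $K$ with $|\pi| = q^{-1}$ for any uniformiser $\pi$. Let $\mathsf{A}$ be a (possibly non-associative) $\mathfrak{O}$-algebra whose underlying $\mathfrak{O}$-module is free with basis $a_1,\dots,a_d$. Let $0=\beta_1<\beta_2<\dots<\beta_{r+1}=d$ and set $\mathsf{A}_i=\mathfrak{O}a_{1+\beta_i}\oplus\dots\oplus\mathfrak{O}a_{\beta_{i+1}}$ for $i=1,\dots,r$, so that $\mathsf{A}=\mathsf{A}_1\oplus\dots\oplus\mathsf{A}_r$. Let $T$ be the $\mathfrak{O}$-module of block diagonal upper triangular $d\times d$ matrices over $\mathfrak{O}$ with diagonal blocks of sizes $\beta_2-\beta_1,\dots,\beta_{r+1}-\beta_r$, and let $M(\mathbf{X})$ be the generic matrix of this shape: $M(\mathbf{X})$ is block diagonal, its $i$-th diagonal block is the upper triangular matrix with entries $X_{a,b}$ for $1+\beta_i\le a\le b\le \beta_{i+1}$, and all other entries are $0$. Let $R=\mathfrak{O}[\mathbf{X}]$ (polynomial ring in these variables) and let $\star\colon R^d\times R^d\to R^d$ be the $R$-bilinear map obtained by base extension from the multiplication of $\mathsf{A}$ written in coordinates with respect to $a_1,\dots,a_d$. Let $F\subset R$ be the set of all entries of all row vectors $(M_i(\mathbf{X})\star M_j(\mathbf{X}))\,\mathrm{adj}(M(\mathbf{X}))$ for $1\le i,j\le d$, where $M_i(\mathbf{X})$ denotes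 the $i$-th row of $M(\mathbf{X})$ and $\mathrm{adj}$ denotes the adjugate matrix. Define $$V=\{\mathbf{x}\in T:\ \det(M(\mathbf{x}))\text{ divides } f(\mathbf{x}) \text{ in }\mathfrak{O}\text{ for all } f\in F\}.$$ Let $\mu$ be the normalised Haar measure on $T\cong\mathfrak{O}^{\sum_{i=1}^r\binom{\beta_{i+1}-\beta_i+1}{2}}$. Then $$\zeta^{\mathrm{gr}\le}_{\mathsf{A}}(s)=(1-q^{-1})^{-d}\int_V\prod_{i=1}^r\prod_{j=1}^{\beta_{i+1}-\beta_i}|x_{j+\beta_i,\,j+\beta_i}|^{s-j}\,d\mu(\mathbf{x}).$$
   Context: For a commutative ring $R$ and an $R$-algebra $\mathsf{A}$ with a decomposition $\mathsf{A}=\mathsf{A}_1\oplus\dots\oplus\mathsf{A}_r$ of $R$-modules (not required to be compatible with multiplication), an $R$-submodule $\mathsf{U}\le\mathsf{A}$ is homogeneous if $\mathsf{U}=\mathsf{U}_1\oplus\dots\oplus\mathsf{U}_r$ with $\mathsf{U}_i\le\mathsf{A}_i$ submodules. The graded subalgebra zeta function is $\zeta^{\mathrm{gr}\le}_{\mathsf{A}}(s)=\sum_{\mathsf{U}}[\mathsf{A}:\mathsf{U}]^{-s}$, the sum ranging over homogeneous $R$-subalgebras $\mathsf{U}$ (submodules closed under multiplication, not required to contain an identity) such that $\mathsf{A}/\mathsf{U}$ is finite, $[\mathsf{A}:\mathsf{U}]$ denoting its cardinality. The identity is one of functions of a complex variable $s$ where both sides converge (some right half-plane). *)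

(* Defs.v *)
From HB Require Import structures.
From mathcomp Require Import all_boot all_order all_algebra.
From mathcomp Require Import all_classical all_reals all_analysis.
From mathcomp Require Import complex.

Set Implicit Arguments.
Unset Strict Implicit.
Unset Printing Implicit Defensive.

Import Order.TTheory GRing.Theory Num.Theory.
Local Open Scope classical_set_scope.
Local Open Scope ring_scope.

Section Valuation.
Variable O : idomainType.

Definition dvdO (a b : O) : Prop := exists c : O, b = a * c.

(* pi is a uniformiser: O is a discrete valuation ring with maximal
   ideal pi O (every nonzero element is a unit times a power of pi). *)
Definition uniformiser (pi : O) : Prop :=
  [/\ pi != 0, pi \notin GRing.unit &
      forall x : O, x != 0 ->
        exists (u : O) (n : nat), u \is a GRing.unit /\ x = u * pi ^+ n].

Definition residue_card (pi : O) (q : nat) : Prop :=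
  exists rep : 'I_q -> O,
    (forall i j, dvdO pi (rep i - rep j) -> i = j) /\
    (forall x : O, exists i, dvdO pi (x - rep i)).

Definition pi_complete (pi : O) : Prop :=
  forall x : nat -> O, (forall n, dvdO (pi ^+ n) (x n.+1 - x n)) ->
    exists y : O, forall n, dvdO (pi ^+ n) (y - x n).

(* O is the valuation ring of a non-Archimedean local field (its fraction
   field), with uniformiser pi and residue field of size q: a complete
   discrete valuation ring with finite residue field of size q. *)
Definition local_valuation_ring (pi : O) (q : nat) : Prop :=
  [/\ uniformiser pi, residue_card pi q & pi_complete pi].

Definition valO (pi : O) (x : O) : nat :=
  xget 0%N [set n : nat | dvdO (pi ^+ n) x /\ ~ dvdO (pi ^+ n.+1) x].

Definition absO (R : realType) (pi : O) (q : nat) (x : O) : R :=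
  if x == 0 then 0 else ((q%:R : R) ^- (valO pi x)).

End Valuation.

(* Complex powers a^z = exp(z log a) of a nonnegative real a           *)

Definition cpow (R : realType) (a : R) (z : R[i]) : R[i] :=
  if a == 0 then 0
  else Complex (a `^ (complex.Re z)) 0 * Complex (cos (complex.Im z * ln a)) (sin (complex.Im z * ln a)).

(* The algebra A = O^d with basis a_1..a_d and structure constants c:  *)
(* a_i a_j = sum_k (c i j) k a_k.  The product in coordinates:         *)

Definition star (Rg : comNzRingType) (d : nat) (c : 'I_d -> 'I_d -> 'rV[Rg]_d)
  (x y : 'rV[Rg]_d) : 'rV[Rg]_d :=
  \sum_(i < d) \sum_(j < d) (x 0 i * y 0 j) *: c i j.

(* blocks: 0-based, block i (i < r) consists of the (0-based) coordinates
   k with beta i <= k < beta (i+1); beta 0 = 0 and beta r = d. *)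
Definition inblock (beta : nat -> nat) (i k : nat) : bool :=
  ((beta i <= k) && (k < beta i.+1))%N.

Section Subalgebras.
Variables (O : idomainType) (d r : nat) (beta : nat -> nat)
          (c : 'I_d -> 'I_d -> 'rV[O]_d).

Definition Acomp (i : nat) : set 'rV[O]_d :=
  [set x | forall k : 'I_d, ~~ inblock beta i k -> x 0 k = 0].

Definition submoduleO (U : set 'rV[O]_d) : Prop :=
  [/\ U 0, (forall x y, U x -> U y -> U (x + y)) &
      (forall (a : O) x, U x -> U (a *: x))].

Definition subalgebraO (U : set 'rV[O]_d) : Prop :=
  submoduleO U /\ (forall x y, U x -> U y -> U (star c x y)).

Definition homogeneous (U : set 'rV[O]_d) : Prop :=
  exists Ui : nat -> set 'rV[O]_d,
    (forall i, (i < r)%N -> submoduleO (Ui i) /\ Ui i `<=` Acomp i) /\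
    U = [set x | exists u : 'I_r -> 'rV[O]_d,
                   (forall i : 'I_r, Ui i (u i)) /\ x = \sum_(i < r) u i].

Definition has_index (U : set 'rV[O]_d) (n : nat) : Prop :=
  exists rep : 'I_n -> 'rV[O]_d,
    (forall i j, U (rep i - rep j) -> i = j) /\
    (forall x, exists i, U (x - rep i)).

Definition indexO (U : set 'rV[O]_d) : nat := xget 0%N [set n | has_index U n].

Definition gr_subalgebras : set (set 'rV[O]_d) :=
  [set U | [/\ subalgebraO U, homogeneous U & exists n, has_index U n]].

End Subalgebras.

Definition zeta_term (R : realType) (O : idomainType) (d : nat)
  (s : R[i]) (U : set 'rV[O]_d) : R[i] :=
  cpow ((indexO U)%:R : R) (- s).

Definition esum_signed (R : realType) (T : choiceType) (D : set T) (f : T -> R)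
  : \bar R :=
  (\esum_(t in D) (EFin \o f)^\+ t - \esum_(t in D) (EFin \o f)^\- t)%E.

Definition csum (R : realType) (T : choiceType) (D : set T) (f : T -> R[i]) : R[i] :=
  Complex (fine (esum_signed D (fun t => complex.Re (f t)))) (fine (esum_signed D (fun t => complex.Im (f t)))).

Definition zeta_converges (R : realType) (O : idomainType) (d r : nat)
  (beta : nat -> nat) (c : 'I_d -> 'I_d -> 'rV[O]_d) (s : R[i]) : Prop :=
  (\esum_(U in gr_subalgebras r beta c)
      (((indexO U)%:R : R) `^ (- complex.Re s))%:E < +oo)%E.

Definition zeta_gr (R : realType) (O : idomainType) (d r : nat)
  (beta : nat -> nat) (c : 'I_d -> 'I_d -> 'rV[O]_d) (s : R[i]) : R[i] :=
  csum (gr_subalgebras r beta c) (@zeta_term R O d s).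

Definition Tpred (d r : nat) (beta : nat -> nat) (p : 'I_d * 'I_d) : bool :=
  [exists i : 'I_r, inblock beta i p.1 && inblock beta i p.2] && (p.1 <= p.2)%N.

Definition Tidx (d r : nat) (beta : nat -> nat) : finType :=
  {p : 'I_d * 'I_d | Tpred r beta p}.

Definition Tsp (O : idomainType) (d r : nat) (beta : nat -> nat) :=
  {ffun Tidx d r beta -> O}.
Section TspInstances.
Variables (O : idomainType) (d r : nat) (beta : nat -> nat).
HB.instance Definition _ := GRing.Zmodule.on (Tsp O d r beta).
HB.instance Definition _ := isPointed.Build (Tsp O d r beta) 0.
End TspInstances.


Definition Tball (O : idomainType) (d r : nat) (beta : nat -> nat) (pi : O)
  (a : Tsp O d r beta) (k : nat) : set (Tsp O d r beta) :=
  [set x | forall p, dvdO (pi ^+ k) (x p - a p)].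

Definition Tballs (O : idomainType) (d r : nat) (beta : nat -> nat) (pi : O)
  : set (set (Tsp O d r beta)) :=
  [set B | exists a k, B = @Tball O d r beta pi a k].

(* T with its Borel sigma-algebra (generated by the balls) *)
Notation Tmeas O d r beta pi :=
  (g_sigma_algebraType (@Tballs O d r beta pi)).

Definition normalised_haar (R : realType) (O : idomainType) (d r : nat)
  (beta : nat -> nat) (pi : O)
  (mu : {measure set (Tmeas O d r beta pi) -> \bar R}) : Prop :=
  mu setT = 1%E /\
  forall (A : set (Tmeas O d r beta pi)) (a : Tsp O d r beta),
    measurable A -> mu [set a + x | x in A] = mu A.

Definition Mgen (O : idomainType) (d r : nat) (beta : nat -> nat)
  (x : Tsp O d r beta) : 'M[O]_d :=
  \matrix_(a < d, b < d)
     match @insub _ (Tpred r beta) (Tidx d r beta) (a, b) with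
     | Some p => x p
     | None => 0
     end.

Definition mentry (O : idomainType) (d : nat) (A : 'M[O]_d) (a b : nat) : O :=
  match @insub _ (fun k => (k < d)%N) 'I_d a, @insub _ (fun k => (k < d)%N) 'I_d b with
  | Some i, Some j => A i j
  | _, _ => 0
  end.

(* V = { x in T : det M(x) | f(x) for all f in F }, where F is the set of
   entries of (M_i(X) * M_j(X)) adj(M(X)); f(x) is computed by evaluating
   at X = x, i.e. as the corresponding entry of (M_i(x) * M_j(x)) adj(M(x)) *)
Definition Vset (O : idomainType) (d r : nat) (beta : nat -> nat)
  (c : 'I_d -> 'I_d -> 'rV[O]_d) (pi : O) : set (Tmeas O d r beta pi) :=
  [set x | forall i j k : 'I_d,
     dvdO (\det (Mgen x))
          ((star c (row i (Mgen x)) (row j (Mgen x)) *m \adj (Mgen x)) 0 k)].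

(* integrand prod_i prod_{j=1}^{beta_{i+1}-beta_i} |x_{j+beta_i, j+beta_i}|^(s-j)
   (0-based: j' = j - 1, diagonal position beta i + j') *)
Definition integrand (R : realType) (O : idomainType) (d r : nat)
  (beta : nat -> nat) (pi : O) (q : nat) (s : R[i]) (x : Tsp O d r beta) : R[i] :=
  \prod_(i < r) \prod_(j < beta i.+1 - beta i)
     cpow (absO R pi q (mentry (Mgen x) (beta i + j) (beta i + j))) (s - (j.+1)%:R).

Definition cintegral (R : realType) (dsp : measure_display) (T : measurableType dsp)
  (mu : {measure set T -> \bar R}) (D : set T) (f : T -> R[i]) : R[i] :=
  Complex (fine (\int[mu]_(x in D) (complex.Re (f x))%:E)%E) (fine (\int[mu]_(x in D) (complex.Im (f x))%:E)%E).

(* Main.v *)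
(** A homogeneous finite-index submodule [U] is the row span of a nondegenerate
    matrix [M(h)] of the prescribed shape (Hermite form).  The matrices of this
    shape with row span [U] are the products [M(y) M(h)] with [y] triangular
    with unit diagonal.  They form a disjoint union of [(q - 1)^d] cosets of the
    group [{M(y) M(h) : diag y in pi O}], whose index is a power of [q] read off
    from the triangular map [y |-> M(y) M(h)]; hence this set has measure
    [(1 - 1/q)^d prod_k |h_kk|^(n_k)], where [n_k] is the position of [k] in its
    block.  On it the integrand is constant, equal to
    [[A : U]^(-s) prod_k |h_kk|^(-n_k)], and by Cramer's rule [M(h)] lies in [V]
    iff [U] is a subalgebra.  Summing over the (countably many) [U] gives the
    formula; where [det M(x) = 0] the integrand vanishes. *)

Require Import Defs.
From HB Require Import structures.
From mathcomp Require Import all_boot all_order all_algebra.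
From mathcomp Require Import all_classical all_reals all_analysis.
From mathcomp Require Import complex.
From mathcomp Require Import measurable_realfun finmap ring.
Set Implicit Arguments.
Unset Strict Implicit.
Unset Printing Implicit Defensive.

Import Order.TTheory GRing.Theory Num.Theory.
Local Open Scope classical_set_scope.
Local Open Scope ring_scope.

(** * Transversals of subgroups of abelian groups *)

Section Transversals.

(** [has_index] and [residue_card] use ordinals to index representatives; here any finite type may
    do so, so that products and dependent function types can serve directly. *)
Definition transversal (V : zmodType) (G : V -> Prop) (F : finType) (rep : F -> V) :=
  (forall i j, G (rep i - rep j) -> i = j) /\ (forall x, exists i, G (x - rep i)).

Definition addsubgroup (V : zmodType) (G : V -> Prop) :=
  G 0 /\ (forall x y, G x -> G y -> G (x - y)).

Lemma addsubgroupN (V : zmodType) (G : V -> Prop) x :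
  addsubgroup G -> G x -> G (- x).
Proof. by case=> G0 GB Gx; rewrite -sub0r; apply: GB. Qed.

Lemma addsubgroupD (V : zmodType) (G : V -> Prop) x y :
  addsubgroup G -> G x -> G y -> G (x + y).
Proof.
by move=> sG Gx Gy; rewrite -[y]opprK; apply: sG.2 => //; apply: addsubgroupN.
Qed.

Lemma transversal_leq (V : zmodType) (G : V -> Prop) (F F' : finType)
    (rep : F -> V) (rep' : F' -> V) :
  addsubgroup G -> transversal G rep -> transversal G rep' ->
  (#|F| <= #|F'|)%N.
Proof.
move=> sG [inj _] [_ sur].
have [f hf] : exists f : F -> F', forall i, G (rep i - rep' (f i)).
  by exists (fun i => projT1 (cid (sur (rep i)))) => i; case: cid.
apply: (@leq_card _ _ f) => i j eij; apply: inj.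
have := sG.2 _ _ (hf i) (hf j); rewrite eij opprB addrA subrK; exact.
Qed.

Lemma transversal_card (V : zmodType) (G : V -> Prop) (F F' : finType)
    (rep : F -> V) (rep' : F' -> V) :
  addsubgroup G -> transversal G rep -> transversal G rep' ->
  #|F| = #|F'|.
Proof.
by move=> sG t t'; apply/eqP; rewrite eqn_leq; apply/andP; split;
  [apply: transversal_leq sG t t'|apply: transversal_leq sG t' t].
Qed.

Lemma transversal_ord (V : zmodType) (G : V -> Prop) (F : finType) (rep : F -> V) n :
  #|F| = n -> transversal G rep -> exists rep' : 'I_n -> V, transversal G rep'.
Proof.
move=> <- [inj sur]; exists (rep \o enum_val); split=> [i j /inj/enum_val_inj //|x].
by have [i hi] := sur x; exists (enum_rank i); rewrite /= enum_rankK.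
Qed.

End Transversals.

(** * Divisibility and residue systems modulo products *)

Section DivisibilityRelation.
Variable O : idomainType.
Implicit Types a b x y : O.

Lemma dvdO_mulr a x : dvdO a (a * x). Proof. by exists x. Qed.

Lemma dvdOD a x y : dvdO a x -> dvdO a y -> dvdO a (x + y).
Proof. by move=> [u ->] [v ->]; exists (u + v); rewrite mulrDr. Qed.

Lemma dvdON a x : dvdO a x -> dvdO a (- x).
Proof. by move=> [u ->]; exists (- u); rewrite mulrN. Qed.

Lemma dvdOB a x y : dvdO a x -> dvdO a y -> dvdO a (x - y).
Proof. by move=> ax ay; apply/dvdOD/dvdON. Qed.

Lemma dvdOMl a x y : dvdO a x -> dvdO a (x * y).
Proof. by move=> [u ->]; exists (u * y); rewrite mulrA. Qed.

Lemma dvdO_trans b a x : dvdO a b -> dvdO b x -> dvdO a x.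
Proof. by move=> [u ->] [v ->]; exists (u * v); rewrite mulrA. Qed.

Lemma dvdO0 a : dvdO a 0. Proof. by exists 0; rewrite mulr0. Qed.

Lemma dvdO_exp a m n : (m <= n)%N -> dvdO (a ^+ m) (a ^+ n).
Proof. by move=> mn; exists (a ^+ (n - m)); rewrite -exprD subnKC. Qed.

(** Two-digit expansion: a remainder modulo a, plus a times a remainder modulo b. *)
Lemma transversal_mul a b (F F' : finType) (rep : F -> O) (rep' : F' -> O) : a != 0 ->
  transversal (dvdO a) rep -> transversal (dvdO b) rep' ->
  transversal (dvdO (a * b)) (fun p : F * F' => rep p.1 + a * rep' p.2).
Proof.
move=> a0 [inj sur] [inj' sur']; split=> [[i i'] [j j'] /= h|x].
  have eij : i = j.
    apply: inj; have -> : rep i - rep j =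
        rep i + a * rep' i' - (rep j + a * rep' j') - a * (rep' i' - rep' j').
      by ring.
    apply: dvdOB (dvdO_mulr _ _); apply: dvdO_trans h; exact: dvdO_mulr.
  move: h; rewrite -eij opprD addrACA subrr add0r -mulrBr => -[c].
  by rewrite -mulrA => /(mulfI a0) h; congr pair; apply: inj'; exists c.
have [i [c hc]] := sur x; have [j [e he]] := sur' c; exists (i, j); exists e => /=.
by rewrite opprD addrA hc -mulrBr he mulrA.
Qed.

End DivisibilityRelation.

(** * Valuations and the size of O/xO *)

Section Uniformiser.
Variables (O : idomainType) (pi : O) (q : nat).
Hypothesis hO : local_valuation_ring pi q.

Lemma pi_neq0 : pi != 0. Proof. by case: hO => -[]. Qed.

Lemma piX_neq0 n : pi ^+ n != 0. Proof. by rewrite expf_neq0 // pi_neq0. Qed.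

Lemma dvdO_piN1 : ~ dvdO pi 1.
Proof.
case: hO => -[_ /negP npi _] _ _ [c e]; apply: npi.
by apply/unitrP; exists c; rewrite mulrC -e.
Qed.

Lemma dvdO_pi_unit x : x \is a GRing.unit -> ~ dvdO pi x.
Proof.
move=> ux h; apply: dvdO_piN1; rewrite -(mulrV ux); exact: dvdOMl.
Qed.

(** [valO] selects some exact exponent of pi; comparison with a factorisation x = u pi^n shows that
    n is the only candidate, since pi divides no unit. *)
Lemma valO_decomp x : x != 0 ->
  exists u : O, u \is a GRing.unit /\ x = u * pi ^+ valO pi x.
Proof.
move=> x0; case: (hO) => -[_ _ /(_ x x0) [u [n [uu ex]]]] _ _.
exists u; split=> //; rewrite {1}ex; congr (u * pi ^+ _).
have key m : dvdO (pi ^+ m) x /\ ~ dvdO (pi ^+ m.+1) x -> m = n.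
  move=> [hm hm1]; apply/eqP; rewrite eqn_leq; apply/andP; split; rewrite leqNgt; apply/negP.
    move=> nm; have := dvdO_trans (dvdO_exp pi nm) hm.
    rewrite ex exprS [u * _]mulrC => -[c].
    rewrite [pi * _]mulrC -mulrA => /(mulfI (piX_neq0 n)) e.
    by apply: (dvdO_pi_unit uu); exists c.
  move=> mn; apply: hm1; apply: dvdO_trans (dvdO_exp pi mn) _.
  by exists u; rewrite mulrC.
have hn : dvdO (pi ^+ n) x /\ ~ dvdO (pi ^+ n.+1) x.
  split; first by exists u; rewrite ex mulrC.
  rewrite ex exprS [u * _]mulrC => -[c]; rewrite [pi * _]mulrC -mulrA => /(mulfI (piX_neq0 n)) e.
  by apply: (dvdO_pi_unit uu); exists c.
symmetry; apply: key.
exact: (@xgetPex _ 0%N [set m | dvdO (pi ^+ m) x /\ ~ dvdO (pi ^+ m.+1) x] (ex_intro _ n hn)).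
Qed.

Lemma dvdO_valO x y : x != 0 -> (y == 0) || (valO pi x <= valO pi y)%N -> dvdO x y.
Proof.
move=> x0; have [u [uu eu]] := valO_decomp x0.
case: (eqVneq y 0) => [-> _|y0 /= le]; first exact: dvdO0.
have [v [uv ev]] := valO_decomp y0.
set m := valO pi y in ev le *; set n := valO pi x in eu le *.
exists (u^-1 * v * pi ^+ (m - n)); rewrite {1}eu {1}ev -(subnKC le) exprD addKn.
rewrite [RHS](_ : _ = (u * u^-1) * (v * (pi ^+ n * pi ^+ (m - n)))); last by ring.
by rewrite mulrV // mul1r.
Qed.

(** Each further factor pi appends one residue digit, which multiplies the index by q. The unit u
    stays in front throughout, so that the final modulus is x itself. *)
Lemma transversal_dvdO x : x != 0 ->
  exists (F : finType) (rep : F -> O),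
    #|F| = (q ^ valO pi x)%N /\ transversal (dvdO x) rep.
Proof.
move=> x0; have [u [uu e]] := valO_decomp x0.
suff : forall n, exists (F : finType) (rep : F -> O),
    #|F| = (q ^ n)%N /\ transversal (dvdO (u * pi ^+ n)) rep.
  by move=> /(_ (valO pi x)); rewrite -e.
elim=> [|n [F [rep [cF tF]]]].
  exists unit, (fun=> 0); rewrite card_unit expn0; split=> //; split=> [[] []//|y].
  by exists tt; rewrite subr0 expr0 mulr1 -(mulKr uu y) mulrCA; apply: dvdO_mulr.
case: (hO) => _ [r tr] _; exists (F * 'I_q)%type, (fun p => rep p.1 + (u * pi ^+ n) * r p.2).
rewrite card_prod cF card_ord -expnSr; split=> //.
rewrite exprSr mulrA; apply: transversal_mul => //.
by rewrite mulf_neq0 ?piX_neq0 //; apply: contraTneq uu => ->; rewrite unitr0.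
Qed.


End Uniformiser.

(** * Index of the image of a triangular map *)

Section Triangular.
Variables (O : idomainType) (I : finType) (rk : I -> nat).
Variables (a : I -> O) (g : I -> (I -> O) -> O).
Hypothesis a_neq0 : forall p, a p != 0.
Hypothesis g_lower : forall p y y',
  (forall p', (rk p' < rk p)%N -> y p' = y' p') -> g p y = g p y'.

Section Transversal.
Variables (N : I -> nat) (rep : forall p, 'I_(N p) -> O).
Hypothesis repP : forall p, transversal (dvdO (a p)) (@rep p).

(** Division with remainder by increasing rank: [g p] sees only coordinates of smaller rank, so it
    is already fixed when the quotient at p is chosen. *)
Lemma triangular_surj (x : I -> O) :
  exists (y : I -> O) (z : {dffun forall p, 'I_(N p)}),
    forall p, x p = a p * y p + g p y + rep (z p).
Proof.
have step n : exists y : I -> O, forall p, (rk p < n)%N ->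
    exists i : 'I_(N p), x p - g p y - rep i = a p * y p.
  elim: n => [|n [y hy]]; first by exists (fun=> 0).
  (* Quotients are computed at every coordinate from the current y; only those of rank n are
     adopted. *)
  have [c hc] : exists c : I -> O, forall p, exists i : 'I_(N p), x p - g p y - rep i = a p * c p.
    apply: (@fin_all_exists I (fun=> O)
      (fun p c => exists i : 'I_(N p), x p - g p y - rep i = a p * c)) => p.
    by have [i [c hc]] := (repP p).2 (x p - g p y); exists c, i.
  exists (fun p => if rk p == n then c p else y p) => p; rewrite ltnS leq_eqVlt.
  have glow : (rk p <= n)%N -> g p (fun p => if rk p == n then c p else y p) = g p y.
    by move=> pn; apply: g_lower => p' p'p; rewrite ltn_eqF // (leq_trans p'p).
  case: eqP => [pn _|_ /= pn]; first by rewrite glow ?pn.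
  by rewrite glow ?(ltnW pn) //; exact: hy.
have [y hy] := step (\max_(p0 : I) rk p0)%N.+1.
have [z hz] : exists z : forall p, 'I_(N p), forall p, x p - g p y - rep (z p) = a p * y p.
  by apply: (@fin_all_exists I _
    (fun p z => x p - g p y - rep z = a p * y p)) => p; apply: hy; rewrite ltnS; exact: (@leq_bigmax I rk p).
by exists y, (finfun z) => p; rewrite ffunE -hz; ring.
Qed.

(** Induction on the rank: equal lower coordinates give equal [g p], so the remainders agree modulo
    [a p] and coincide; then [a p] is cancelled. *)
Lemma triangular_inj (y y' : I -> O) (z z' : forall p, 'I_(N p)) :
  (forall p, a p * y p + g p y + rep (z p) = a p * y' p + g p y' + rep (z' p)) ->
  forall p, z p = z' p.
Proof.
move=> e.
suff h n p : (rk p < n)%N -> y p = y' p /\ z p = z' p.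
  by move=> p; have [] := h (rk p).+1 p.
elim: n p => // n IH p; rewrite ltnS => pn.
have eg : g p y = g p y'.
  by apply: g_lower => p' p'p; have [] := IH p' (leq_trans p'p pn).
have ez : z p = z' p.
  apply: (repP p).1; exists (y' p - y p); rewrite mulrBr.
  have := e p; rewrite eg ![_ + g p y' + _]addrAC => /addIr ee.
  have -> : rep (z p) = a p * y p + rep (z p) - a p * y p by ring.
  by rewrite ee; ring.
split=> //; apply: (mulfI (a_neq0 p)).
by have := e p; rewrite eg ez => /addIr/addIr.
Qed.

Hypothesis g0 : forall p, g p (fun=> 0) = 0.

(** [co] reads coordinates and [mk] builds an element from them, so that the result covers both row
    vectors and points of T. *)
Lemma triangular_transversal (V : zmodType) (co : V -> I -> O) (mk : (I -> O) -> V)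
    (G : V -> Prop) :
  (forall h p, co (mk h) p = h p) ->
  (forall v w p, co (v - w) p = co v p - co w p) ->
  (forall v, G v <-> exists y, forall p, co v p = a p * y p + g p y) ->
  transversal G (fun z : {dffun forall p, 'I_(N p)} => mk (fun p => rep (z p))).
Proof.
move=> mkK coB hG; split=> [z z' /hG[y hy]|x].
  (* The same element has quotient 0 with remainder z, and quotient y with remainder z'. *)
  apply/ffunP; apply: (@triangular_inj (fun=> 0) y) => p.
  by rewrite mulr0 g0 !add0r -hy coB !mkK subrK.
have [y [z hz]] := triangular_surj (co x).
by exists z; apply/hG; exists y => p; rewrite coB mkK hz addrK.
Qed.

End Transversal.

(** The index is the product of the indices q^(v p) of the diagonal coefficients; the lower terms
    [g] do not affect it. *)
Lemma triangular_index (q : nat) (v : I -> nat) (V : zmodType) (co : V -> I -> O)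
    (mk : (I -> O) -> V) (G : V -> Prop) :
  (forall p, exists (F : finType) (rep : F -> O),
    #|F| = (q ^ v p)%N /\ transversal (dvdO (a p)) rep) ->
  (forall p, g p (fun=> 0) = 0) ->
  (forall h p, co (mk h) p = h p) ->
  (forall v w p, co (v - w) p = co v p - co w p) ->
  (forall v, G v <-> exists y, forall p, co v p = a p * y p + g p y) ->
  exists (F : finType) (rep : F -> V),
    #|F| = (q ^ (\sum_p v p))%N /\ transversal G rep.
Proof.
move=> tr g0 mkK coB hG.
have [rep repP] : exists rep : forall p, 'I_(q ^ v p) -> O,
    forall p, transversal (dvdO (a p)) (@rep p).
  apply: (@fin_all_exists I _ (fun p r => transversal (dvdO (a p)) r)) => p; have [F [r [cF tF]]] := tr p.
  exact: transversal_ord cF tF.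
exists {dffun forall p, 'I_(q ^ v p)}; eexists; split; last first.
  by apply: triangular_transversal repP g0 _ _ _ _ mkK coB hG.
rewrite card_dep_ffun foldrE big_image /=.
by under eq_bigr do rewrite card_ord; rewrite expn_sum.
Qed.

End Triangular.

(** * Block structure of the coordinates *)

Section Blocks.
Variables (d r : nat) (beta : nat -> nat).
Hypotheses (hb0 : beta 0%N = 0%N) (hbr : beta r = d).
Hypothesis hbinc : forall i : nat, (i < r)%N -> (beta i < beta i.+1)%N.

Lemma beta_homo i j : (i <= j <= r)%N -> (beta i <= beta j)%N.
Proof.
elim: j => [|j IH]; first by rewrite leqn0 => /andP[/eqP ->].
rewrite leq_eqVlt => /andP[/orP[/eqP <-//|ij] jr].
by rewrite (leq_trans (IH _)) ?(ltnW (hbinc _)) // (ltnW jr) andbT -ltnS.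
Qed.

(** The block of k ends at the least beta m exceeding k; monotonicity of beta excludes all
    others. *)
Lemma block_exists (k : 'I_d) :
  exists i : 'I_r, forall j : 'I_r, inblock beta j k = (j == i).
Proof.
have /ex_minnP[m hm mmin] : exists m, (k < beta m)%N by exists r; rewrite hbr.
case: m hm mmin => [|m] hm mmin; first by rewrite hb0 in hm.
have mr : (m < r)%N by apply: mmin; rewrite hbr.
exists (Ordinal mr) => j; rewrite /inblock; apply/andP/eqP => [ [jk kj] |->].
  apply/val_inj/eqP; rewrite eqn_leq /= (mmin _ kj : m <= j)%N andbT.
  rewrite leqNgt; apply/negP => mj.
  have := leq_trans hm (leq_trans (beta_homo (i := m.+1) (j := j) _) jk).
  by rewrite ltnn mj ltnW // => /(_ isT).
split=> //=; rewrite leqNgt; apply/negP => km; have := mmin _ km; by rewrite ltnn.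
Qed.

Definition block (k : 'I_d) : 'I_r := projT1 (cid (block_exists k)).

Lemma inblockE (i : 'I_r) (k : 'I_d) : inblock beta i k = (i == block k).
Proof. by rewrite /block; case: cid. Qed.

Lemma TpredE (a b : 'I_d) : Tpred r beta (a, b) = (block a == block b) && (a <= b)%N.
Proof.
rewrite /Tpred /=; congr (_ && _); apply/existsP/eqP => [[i ]|e].
  by rewrite !inblockE => /andP[/eqP <- /eqP <-].
by exists (block a); rewrite !inblockE -e eqxx.
Qed.

Lemma Tpred_refl (a : 'I_d) : Tpred r beta (a, a). Proof. by rewrite TpredE eqxx leqnn. Qed.

Lemma Tpred_trans (b a c : 'I_d) : Tpred r beta (a, b) -> Tpred r beta (b, c) -> Tpred r beta (a, c).
Proof.
by rewrite !TpredE => /andP[/eqP -> ab] /andP[/eqP -> bc]; rewrite eqxx (leq_trans ab bc).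
Qed.

Lemma Tpred_leq (a b : 'I_d) : Tpred r beta (a, b) -> (a <= b)%N.
Proof. by rewrite TpredE => /andP[]. Qed.

(** Column b runs from the start of its block down to the diagonal. The count is the position n_b of
    b in its block, starting from 1. *)
Lemma card_Tpred (b : 'I_d) :
  (\sum_(a < d | Tpred r beta (a, b)) 1 = b.+1 - beta (block b))%N.
Proof.
have /andP[lb _] : inblock beta (block b) b by rewrite inblockE.
transitivity (\sum_(0 <= a < d | (beta (block b) <= a < b.+1)) 1)%N.
  rewrite big_mkord; apply: eq_bigl => a; rewrite TpredE ltnS.
  apply/andP/andP => [ [/eqP e ->] |[la ab]]; split=> //.
    by rewrite -e; have := inblockE (block a) a; rewrite eqxx => /andP[].
  rewrite eq_sym -inblockE /inblock la (leq_ltn_trans ab) //.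
  by have := inblockE (block b) b; rewrite eqxx => /andP[].
transitivity (\sum_(beta (block b) <= a < b.+1) 1)%N; last by rewrite sum_nat_const_nat muln1.
by rewrite [RHS](big_nat_widenl _ 0) // [RHS](big_nat_widen _ _ d) //.
Qed.

Lemma prod_blocks (S : comNzRingType) (G : nat -> S) :
  \prod_(i < r) \prod_(j < beta i.+1 - beta i) G (beta i + j)%N = \prod_(k < d) G k.
Proof.
suff h n : (n <= r)%N ->
    \prod_(i < n) \prod_(j < beta i.+1 - beta i) G (beta i + j)%N = \prod_(k < beta n) G k.
  by rewrite h // hbr.
elim: n => [|n IH] nr; first by rewrite hb0 !big_ord0.
rewrite big_ord_recr /= IH ?(ltnW nr) // -!(big_mkord xpredT).
rewrite -(big_mkord xpredT (fun j => G (beta n + j)%N)).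
rewrite [RHS](big_cat_nat _ (n := beta n)) //=; last exact/ltnW/hbinc.
congr (_ * _); rewrite -[in RHS](add0n (beta n)) big_addn.
by apply: eq_bigr => j _; rewrite addnC.
Qed.

End Blocks.

(** * Bilinearity of the product *)

Section StarBilinear.
Variables (S : comNzRingType) (d : nat) (c : 'I_d -> 'I_d -> 'rV[S]_d).

Lemma star_sumZl (I : finType) (y : I -> S) (u : I -> 'rV[S]_d) w :
  star c (\sum_i y i *: u i) w = \sum_i y i *: star c (u i) w.
Proof.
rewrite /star; under [RHS]eq_bigr do rewrite scaler_sumr.
rewrite [RHS]exchange_big /=; apply: eq_bigr => a _.
under [RHS]eq_bigr do rewrite scaler_sumr.
rewrite [RHS]exchange_big /=; apply: eq_bigr => b _.
rewrite summxE mulr_suml scaler_suml; apply: eq_bigr => i _.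
by rewrite mxE scalerA mulrA.
Qed.

Lemma star_sumZr (I : finType) (y : I -> S) (u : I -> 'rV[S]_d) w :
  star c w (\sum_i y i *: u i) = \sum_i y i *: star c w (u i).
Proof.
rewrite /star; under [RHS]eq_bigr do rewrite scaler_sumr.
rewrite [RHS]exchange_big /=; apply: eq_bigr => a _.
under [RHS]eq_bigr do rewrite scaler_sumr.
rewrite [RHS]exchange_big /=; apply: eq_bigr => b _.
rewrite summxE mulr_sumr scaler_suml; apply: eq_bigr => i _.
by rewrite mxE scalerA mulrCA.
Qed.

End StarBilinear.

(** * Row spans of block triangular matrices *)

Section Lattices.
Variables (O : idomainType) (d r : nat) (beta : nat -> nat).
Hypotheses (hb0 : beta 0%N = 0%N) (hbr : beta r = d).
Hypothesis hbinc : forall i : nat, (i < r)%N -> (beta i < beta i.+1)%N.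
Local Notation T := (Tsp O d r beta).
Local Notation block := (block hb0 hbr hbinc).
Implicit Types (x y h : T) (A : 'M[O]_d).

Lemma MgenE x (p : Tidx d r beta) : Mgen x (val p).1 (val p).2 = x p.
Proof. by rewrite mxE -surjective_pairing valK. Qed.

Lemma Mgen_out x a b : ~~ Tpred r beta (a, b) -> Mgen x a b = 0.
Proof. by move=> h; rewrite mxE insubN. Qed.

(** Discards the entries outside the shape; inverse to [Mgen] on [shaped] matrices. *)
Definition mkT A : T := [ffun p : Tidx d r beta => A (val p).1 (val p).2].

Definition shaped A := forall a b, ~~ Tpred r beta (a, b) -> A a b = 0.

Lemma Mgen_shaped x : shaped (Mgen x).
Proof. by move=> a b; apply: Mgen_out. Qed.

Lemma mkTK A : shaped A -> Mgen (mkT A) = A.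
Proof.
move=> sA; apply/matrixP => a b; case: (boolP (Tpred r beta (a, b))) => h.
  by have := MgenE (mkT A) (Sub (a, b) h); rewrite ffunE SubK.
by rewrite sA // Mgen_out.
Qed.

Lemma MgenK x : mkT (Mgen x) = x.
Proof. by apply/ffunP => p; rewrite ffunE MgenE. Qed.

Lemma shaped_mul A B : shaped A -> shaped B -> shaped (A *m B).
Proof.
move=> sA sB a b h; rewrite mxE big1 // => k _.
case: (boolP (Tpred r beta (a, k))) => hak; last by rewrite sA ?mul0r.
rewrite sB ?mulr0 //; apply: contra h; exact: (Tpred_trans hb0 hbr hbinc) hak.
Qed.

(** For fixed B this exhibits A |-> [A *m B] as a triangular map, ranked by the column index, with
    diagonal coefficients [B b b]. *)
Lemma shaped_mul_entry m (A : 'M[O]_(m, d)) B a b : shaped B ->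
  (A *m B) a b = A a b * B b b + \sum_(k < d | (k < b)%N) A a k * B k b.
Proof.
move=> sB; rewrite mxE (bigD1 b) //=; congr (_ + _).
rewrite (bigID (fun k : 'I_d => (k < b)%N)) /= addrC big1 ?add0r.
  by apply: eq_bigl => k; case: ltngtP => // kb; rewrite ?andbT ?andbF // -val_eqE /= ?kb ?ltn_eqF.
move=> k /andP[kb]; rewrite -leqNgt => bk.
rewrite sB ?mulr0 //; apply/negP => /(Tpred_leq hb0 hbr hbinc) kb'.
by case/negP: kb; apply/eqP/val_inj/eqP; rewrite eqn_leq kb' bk.
Qed.

Definition nondeg x := forall k, Mgen x k k != 0.

Lemma det_Mgen x : \det (Mgen x) = \prod_k Mgen x k k.
Proof.
rewrite -det_tr det_trig; first by apply: eq_bigr => k _; rewrite mxE.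
apply/is_trig_mxP => a b ab; rewrite mxE Mgen_out //.
by apply/negP => /(Tpred_leq hb0 hbr hbinc); rewrite leqNgt ab.
Qed.

Lemma nondeg_det x : nondeg x <-> \det (Mgen x) != 0.
Proof.
rewrite det_Mgen; split=> [nd|/prodf_neq0 nd k]; last exact: nd.
by apply/prodf_neq0 => k _; apply: nd.
Qed.

(** The adjugate turns M(h) into the nonzero scalar det M(h), which cancels in a domain. *)
Lemma mulmx_Mgen_inj h m (A B : 'M[O]_(m, d)) : nondeg h ->
  A *m Mgen h = B *m Mgen h -> A = B.
Proof.
move=> /nondeg_det dh /(congr1 (fun C => C *m \adj (Mgen h))).
rewrite -!mulmxA mul_mx_adj !mul_mx_scalar => e.
by apply/matrixP => a b; have /matrixP/(_ a b) := e; rewrite !mxE => /(mulfI dh).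
Qed.

Definition rowspan x : set 'rV[O]_d := [set v | exists y : 'rV[O]_d, v = y *m Mgen x].

Lemma rowspan_row x k : rowspan x (row k (Mgen x)).
Proof. by exists (delta_mx 0 k); rewrite rowE. Qed.

Lemma rowspan_submodule x : submoduleO (rowspan x).
Proof.
split=> [|_ _ [y ->] [z ->]|a _ [y ->]]; first by exists 0; rewrite mul0mx.
  by exists (y + z); rewrite mulmxDl.
by exists (a *: y); rewrite -scalemxAl.
Qed.

Lemma submodule_sum (U : set 'rV[O]_d) (I : finType) (y : I -> O) (u : I -> 'rV[O]_d) :
  submoduleO U -> (forall i, U (u i)) -> U (\sum_i y i *: u i).
Proof.
move=> [U0 UD UZ] Uu; apply: (big_ind U) => // i _; exact/UZ/Uu.
Qed.

Lemma submodule_subgroup (U : set 'rV[O]_d) : submoduleO U -> addsubgroup U.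
Proof.
by move=> [U0 UD UZ]; split=> // x y Ux Uy; apply: UD => //; rewrite -scaleN1r; apply: UZ.
Qed.

Lemma rowspan_min x (U : set 'rV[O]_d) : submoduleO U ->
  (forall k, U (row k (Mgen x))) -> rowspan x `<=` U.
Proof. by move=> sU hU _ [y ->]; rewrite mulmx_sum_row; apply: submodule_sum. Qed.

(** Cramer's rule over O: v = y M(x) amounts to v adj M(x) = det M(x) y, so the quotients are the
    coordinates of y. *)
Lemma mem_rowspan_adj x (v : 'rV[O]_d) : nondeg x ->
  rowspan x v <-> forall k, dvdO (\det (Mgen x)) ((v *m \adj (Mgen x)) 0 k).
Proof.
move=> nd; have dx := (nondeg_det x).1 nd; split=> [[y ->] k|hv].
  by rewrite -mulmxA mul_mx_adj mul_mx_scalar mxE; apply: dvdO_mulr.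
have [w hw] := @fin_all_exists _ (fun=> O) (fun k t => _ = _ * t) hv.
exists (\row_k w k); have : \det (Mgen x) *: v = \det (Mgen x) *: (\row_k w k *m Mgen x).
  rewrite -mul_mx_scalar -mul_adj_mx mulmxA [RHS]scalemxAl; congr (_ *m _).
  by apply/rowP => k; rewrite hw !mxE.
by move=> e; apply/rowP => k; have /rowP/(_ k) := e; rewrite !mxE => /(mulfI dx).
Qed.

(** By bilinearity, closure under the product need only be tested on pairs of rows. *)
Lemma rowspan_subalgebra (c : 'I_d -> 'I_d -> 'rV[O]_d) x : nondeg x ->
  subalgebraO c (rowspan x) <->
  forall i j k : 'I_d, dvdO (\det (Mgen x))
    ((star c (row i (Mgen x)) (row j (Mgen x)) *m \adj (Mgen x)) 0 k).
Proof.
move=> nd; split=> [[_ hx] i j|hx].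
  by apply/(mem_rowspan_adj _ nd)/hx; apply: rowspan_row.
split=> [|_ _ [y ->] [z ->]]; first exact: rowspan_submodule.
rewrite !mulmx_sum_row star_sumZl; apply: submodule_sum; first exact: rowspan_submodule.
move=> i; rewrite star_sumZr; apply: submodule_sum; first exact: rowspan_submodule.
by move=> j; apply/(mem_rowspan_adj _ nd)/hx.
Qed.

Definition bproj (i : nat) (v : 'rV[O]_d) : 'rV[O]_d :=
  \row_k (if inblock beta i k then v 0 k else 0).

Lemma sum_bproj v : \sum_(i < r) bproj i v = v.
Proof.
apply/rowP => k; rewrite summxE (bigD1 (block k)) //= mxE inblockE eqxx big1 ?addr0 // => i ik.
by rewrite mxE inblockE (negbTE ik).
Qed.

(** Components in a direct sum are unique: the projection of the sum of the u_j to block i is u_i,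
    which lies in U. *)
Lemma homogeneous_bproj (U : set 'rV[O]_d) (i : 'I_r) v :
  homogeneous r beta U -> U v -> U (bproj i v).
Proof.
move=> [Ui [hUi ->]] [u [hu ->]] /=.
exists (fun j => if j == i then u i else 0); split=> [j|].
  by case: eqP => [->|_] //; have [[]] := hUi j (ltn_ord j).
rewrite -big_mkcond big_pred1_eq; apply/rowP => k; rewrite mxE summxE inblockE.
have out j : j != block k -> u j 0 k = 0.
  move=> jk; have [_ sub] := hUi j (ltn_ord j).
  by apply: sub; rewrite ?inblockE.
case: (eqVneq i (block k)) => [->|ik]; last by rewrite out.
by rewrite (bigD1 (block k)) //= big1 ?addr0.
Qed.

Lemma bproj_mul (i : 'I_r) (y : 'rV[O]_d) x :
  bproj i (y *m Mgen x) = bproj i y *m Mgen x.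
Proof.
apply/rowP => k; rewrite !mxE.
have bl (l : 'I_d) : (if inblock beta i l then y 0 l else 0) * Mgen x l k =
    (if inblock beta i k then y 0 l else 0) * Mgen x l k.
  case: (boolP (Tpred r beta (l, k))) => [|h]; last by rewrite Mgen_out ?mulr0.
  by rewrite (TpredE hb0 hbr hbinc) !inblockE => /andP[/eqP <-].
under [RHS]eq_bigr do rewrite mxE bl.
by case: ifP => // _; rewrite big1 // => l _; rewrite mul0r.
Qed.

(** The components are the intersections with [Acomp], since block projections commute with a block
    diagonal matrix and so preserve the span. *)
Lemma rowspan_homogeneous x : homogeneous r beta (rowspan x).
Proof.
have [W0 WD WZ] := rowspan_submodule x.
exists (fun i => rowspan x `&` Acomp beta i); split=> [i ir|].
  split; last exact: subIsetr.
  split=> [|u v [Wu Au] [Wv Av]|a u [Wu Au]].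
  - by split=> // k _; rewrite mxE.
  - by split; [exact: WD|move=> k ik; rewrite mxE Au ?Av ?addr0].
  - by split; [exact: WZ|move=> k ik; rewrite mxE Au ?mulr0].
apply/seteqP; split=> [v Wv|_ [u [hu ->]]].
  exists (fun i => bproj i v); split; last by rewrite sum_bproj.
  move=> i; split; last by move=> k ik; rewrite mxE (negbTE ik).
  by case: Wv => y ->; exists (bproj i y); rewrite bproj_mul.
by apply: (big_ind (rowspan x)) => // i _; have [] := hu i.
Qed.

End Lattices.

(** * Hermite form of homogeneous submodules of finite index *)

Section HermiteForm.
Variables (O : idomainType) (pi : O) (q : nat).
Hypothesis hO : local_valuation_ring pi q.
Variables (d r : nat) (beta : nat -> nat).
Hypotheses (hb0 : beta 0%N = 0%N) (hbr : beta r = d).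
Hypothesis hbinc : forall i : nat, (i < r)%N -> (beta i < beta i.+1)%N.
Local Notation T := (Tsp O d r beta).
Local Notation block := (block hb0 hbr hbinc).
Implicit Types (x y h : T) (A B : 'M[O]_d).

(** The map y |-> y M(x) is triangular with diagonal coefficients M(x)_kk. *)
Lemma rowspan_transversal x : nondeg x ->
  exists (F : finType) (rep : F -> 'rV[O]_d),
    #|F| = (q ^ (\sum_k valO pi (Mgen x k k)))%N /\ transversal (rowspan x) rep.
Proof.
move=> nd; apply: (@triangular_index _ _ (@nat_of_ord d) (fun k => Mgen x k k)
  (fun k (u : 'I_d -> O) => \sum_(l < d | (l < k)%N) u l * Mgen x l k) nd _
  q (fun k => valO pi (Mgen x k k)) 'rV[O]_d (fun v k => v 0 k) (fun u => \row_k u k)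
  (rowspan x)).
- by move=> k y y' e; apply: eq_bigr => l lk; rewrite e.
- by move=> k; apply: transversal_dvdO.
- by move=> k; rewrite big1 // => l _; rewrite mul0r.
- by move=> y k; rewrite mxE.
- by move=> v w k; rewrite !mxE.
have e (y : 'rV[O]_d) k : (y *m Mgen x) 0 k =
    Mgen x k k * y 0 k + \sum_(l < d | (l < k)%N) y 0 l * Mgen x l k.
  by rewrite (shaped_mul_entry hb0 hbr hbinc) 1?mulrC //; apply: Mgen_shaped.
move=> v; split=> [[y ->]|[y hy]]; first by exists (fun k => y 0 k) => k; rewrite e.
exists (\row_k y k); apply/rowP => k; rewrite e hy.
congr (_ * _ + _); first by rewrite mxE.
by apply: eq_bigr => l _; congr (_ * _); rewrite mxE.
Qed.

Lemma has_index_uniq (U : set 'rV[O]_d) n m :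
  submoduleO U -> has_index U n -> has_index U m -> n = m.
Proof.
move=> /submodule_subgroup sU [f tf] [g tg].
by have := transversal_card sU tf tg; rewrite !card_ord.
Qed.

Lemma rowspan_has_index x : nondeg x ->
  has_index (rowspan x) (q ^ (\sum_k valO pi (Mgen x k k))).
Proof.
move=> /rowspan_transversal[F [rep [cF tF]]]; exact: transversal_ord cF tF.
Qed.

Lemma rowspan_indexO x : nondeg x ->
  indexO (rowspan x) = (q ^ (\sum_k valO pi (Mgen x k k)))%N.
Proof.
move=> nd; apply: xget_unique; first exact: rowspan_has_index.
move=> m hm; apply: has_index_uniq hm (rowspan_has_index nd); exact: rowspan_submodule.
Qed.

Lemma rowspan_gr (c : 'I_d -> 'I_d -> 'rV[O]_d) x : nondeg x ->
  gr_subalgebras r beta c (rowspan x) <-> @Vset O d r beta c pi x.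
Proof.
move=> nd; split=> [[/(rowspan_subalgebra hb0 hbr hbinc _ nd)]//|].
move=> /(rowspan_subalgebra hb0 hbr hbinc _ nd) h; split=> //.
  exact: (rowspan_homogeneous hb0 hbr hbinc).
by eexists; apply: rowspan_has_index.
Qed.

(** Pigeonhole: among the n + 1 vectors pi^m e_k with m <= n, two lie in the same coset. *)
Lemma finite_index_multiple (U : set 'rV[O]_d) n k : submoduleO U -> has_index U n ->
  exists2 a : O, a != 0 & U (a *: delta_mx 0 k).
Proof.
move=> sU [rep [_ sur]]; set e : 'rV[O]_d := delta_mx 0 k.
have [f hf] := @fin_all_exists 'I_n.+1 _ _ (fun m : 'I_n.+1 => sur (pi ^+ m *: e)).
have /injectivePn[m [m' mm' fm]] : ~~ injectiveb f.
  apply/negP => /injectiveP /leq_card; by rewrite !card_ord ltnn.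
wlog lt : m m' mm' fm / (m < m')%N => [H|].
  have := mm'; rewrite -val_eqE neq_ltn => /orP[|] lt; first exact: (H m m').
  by apply: (H m' m) => //; rewrite eq_sym.
exists (pi ^+ m - pi ^+ m'); last first.
  rewrite scalerBl; have := (submodule_subgroup sU).2 _ _ (hf m) (hf m').
  by rewrite fm opprB addrA subrK.
(* If pi^m = pi^m' with m < m', cancelling pi^m makes pi divide 1. *)
apply: contra_notN (dvdO_piN1 hO); rewrite subr_eq0 -(subnKC lt) exprD exprSr => /eqP.
rewrite -[LHS]mulr1 -mulrA => /(mulfI (piX_neq0 hO m)) e1.
by exists (pi ^+ (m' - m.+1)).
Qed.

(** Row k is an element of U in the block of k, zero before k, whose entry at k is nonzero of least
    valuation. Elimination shows that these rows generate U. *)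
Lemma hermite_form (U : set 'rV[O]_d) n :
  submoduleO U -> homogeneous r beta U -> has_index U n ->
  exists2 h : T, nondeg h & U = rowspan h.
Proof.
move=> sU homU ixU.
pose L k v := [/\ U v, Acomp beta (block k) v & forall l : 'I_d, (l < k)%N -> v 0 l = 0].
have Lmin k : exists v, [/\ L k v, v 0 k != 0 &
    forall w, L k w -> dvdO (v 0 k) (w 0 k)].
  pose P m := `[< exists v, [/\ L k v, v 0 k != 0 & valO pi (v 0 k) = m] >].
  have exP : exists m, P m.
    have [a a0 Ua] := finite_index_multiple k sU ixU.
    exists (valO pi a); apply/asboolP; exists (a *: delta_mx 0 k).
    rewrite !mxE !eqxx mulr1; split=> //; split=> // l; rewrite !mxE ?inblockE.
      by case: (eqVneq l k) => [->|lk]; rewrite ?eqxx //= ?mulr0.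
    by move=> lk; rewrite -[l == k]val_eqE ltn_eqF ?andbF ?mulr0.
  case: (ex_minnP exP) => m /asboolP[v [Lv v0 vm]] mmin.
  exists v; split=> // w Lw; apply: (dvdO_valO hO) => //.
  case: eqVneq => //= w0; rewrite vm; apply: mmin; apply/asboolP; by exists w.
have [v hv] := @fin_all_exists _ _ _ Lmin.
pose A := \matrix_k v k.
have sA : shaped r beta A.
  move=> a b; rewrite (TpredE hb0 hbr hbinc) negb_and mxE.
  have [[_ Av lv] _ _] := hv a => /orP[ab|]; last by rewrite -ltnNge => /lv.
  by apply: Av; rewrite inblockE.
pose h := mkT r beta A; have hA : Mgen h = A by apply: mkTK.
have row_h k : row k (Mgen h) = v k by rewrite hA rowK.
have hkk k : Mgen h k k = v k 0 k by rewrite hA mxE.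
exists h; first by move=> k; rewrite hkk; have [] := hv k.
apply/seteqP; split; last by apply: rowspan_min => // k; rewrite row_h; have [[]] := hv k.
(* Induction on m, with w supported on the last m coordinates: the leading coordinate is cleared by
   a multiple of the matching row. *)
suff main m w : U w -> (forall l : 'I_d, (l + m < d)%N -> w 0 l = 0) -> rowspan h w.
  by move=> w /(main d); apply=> l; rewrite ltnNge leq_addl.
elim: m w => [|m IH] w Uw w0.
  have -> : w = 0 by apply/rowP => l; rewrite mxE w0 ?addn0.
  by have [] := rowspan_submodule h.
have [dm|md] := leqP d m.
  by apply: IH => // l; rewrite ltnNge (leq_trans dm) // leq_addl.
have kd : (d - m.+1 < d)%N by rewrite -subSn // subSS leq_subr.
pose k := Ordinal kd.
have ltk (l : 'I_d) : (l + m.+1 < d)%N = (l < k)%N by rewrite ltn_subRL addnC.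
have lek (l : 'I_d) : (l + m < d)%N = (l <= k)%N by rewrite leq_subRL // addSn addnC.
have [[Uv Av lv] v0 vmin] := hv k.
have [t ht] : dvdO (v k 0 k) (w 0 k).
  (* The coordinates of w in other blocks are projected away, because [vmin] concerns vectors
     supported in the block of k. *)
  have := vmin (bproj beta (block k) w); rewrite mxE inblockE eqxx; apply; split.
  - exact: (homogeneous_bproj hb0 hbr hbinc).
  - by move=> l kl; rewrite mxE (negbTE kl).
  - by move=> l lk; rewrite mxE w0 ?ltk //; case: ifP.
have [W0 WD WZ] := rowspan_submodule h.
rewrite -(subrK (t *: v k) w); apply: WD; last by apply: WZ; rewrite -row_h; apply: rowspan_row.
apply: IH; first by apply: (submodule_subgroup sU).2 => //; case: sU => _ _; apply.
move=> l; rewrite lek leq_eqVlt !mxE => /orP[/eqP/val_inj->|lk].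
  by rewrite ht mulrC subrr.
by rewrite lv // w0 ?ltk // mulr0 subrr.
Qed.

(** Induction on the column b: for (a, b) outside the shape, the earlier terms vanish by
    transitivity of the shape, leaving A_ab h_bb = 0. *)
Lemma shaped_left A h : nondeg h -> shaped r beta (A *m Mgen h) -> shaped r beta A.
Proof.
move=> nd sAh a b; have [n] := ubnP b; elim: n b => // n IH b; rewrite ltnS => bn nab.
have := sAh a b nab; rewrite mxE (bigD1 b) //= big1 ?addr0.
  by move/eqP; rewrite mulf_eq0 (negbTE (nd b)) orbF => /eqP.
move=> l lb; case: (boolP (Tpred r beta (l, b))) => hlb; last by rewrite Mgen_out ?mulr0.
have ltlb : (l < b)%N by rewrite ltn_neqAle (Tpred_leq hb0 hbr hbinc) // andbT.
rewrite IH ?mul0r ?(leq_trans ltlb) //.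
by apply: contra nab => /(Tpred_trans hb0 hbr hbinc); apply.
Qed.

Lemma shaped_mul_diag A B k : shaped r beta A -> shaped r beta B ->
  (A *m B) k k = A k k * B k k.
Proof.
move=> sA sB; rewrite (shaped_mul_entry hb0 hbr hbinc) // big1 ?addr0 // => l lk.
rewrite sA ?mul0r //; apply/negP => /(Tpred_leq hb0 hbr hbinc).
by rewrite leqNgt lk.
Qed.

Lemma rowspan_factor x h : rowspan x `<=` rowspan h -> exists A, Mgen x = A *m Mgen h.
Proof.
move=> sub.
have [f hf] := @fin_all_exists _ _ _ (fun k => sub _ (rowspan_row x k)).
exists (\matrix_k f k); apply/row_matrixP => k.
by rewrite hf row_mul rowK.
Qed.

(** Equal spans give M(x) = A M(h) and M(h) = B M(x), hence A B = 1, and the shape makes the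
    diagonal of A consist of units. Conversely, a diagonal of units makes M(y) invertible over O. *)
Lemma rowspan_eqP h x : nondeg h ->
  nondeg x /\ rowspan x = rowspan h <->
  exists2 y : T, (forall k, Mgen y k k \is a GRing.unit) & x = mkT r beta (Mgen y *m Mgen h).
Proof.
move=> nd; split=> [[ndx e]|[y uy ->]].
  have [A hA] : exists A, Mgen x = A *m Mgen h by apply: rowspan_factor; rewrite e.
  have [B hB] : exists B, Mgen h = B *m Mgen x by apply: rowspan_factor; rewrite e.
  have sA : shaped r beta A by apply: (shaped_left nd); rewrite -hA; apply: Mgen_shaped.
  have sB : shaped r beta B by apply: (shaped_left ndx); rewrite -hB; apply: Mgen_shaped.
  have AB : A *m B = 1%:M.
    by apply: (mulmx_Mgen_inj hb0 hbr hbinc ndx); rewrite mul1mx -mulmxA -hB -hA.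
  exists (mkT r beta A) => [k|]; rewrite mkTK //; last by rewrite -hA MgenK.
  apply/unitrP; exists (B k k); rewrite mulrC.
  by rewrite -shaped_mul_diag // AB mxE eqxx.
set x' := mkT _ _ _.
have hx : Mgen x' = Mgen y *m Mgen h.
  by rewrite mkTK //; apply: (shaped_mul hb0 hbr hbinc); apply: Mgen_shaped.
split.
  move=> k; rewrite hx shaped_mul_diag; try exact: Mgen_shaped.
  by rewrite mulf_neq0 // -?unitfE; apply: contraTneq (uy k) => ->; rewrite unitr0.
apply/seteqP; split=> v [z ->]; first by exists (z *m Mgen y); rewrite hx mulmxA.
exists (z *m invmx (Mgen y)); rewrite hx -mulmxA mulKmx // unitmxE.
by rewrite (det_Mgen hb0 hbr hbinc) rpred_prod.
Qed.

End HermiteForm.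

(** * Matrices with a given row span, as a union of cosets *)

Section Fibres.
Variables (O : idomainType) (pi : O) (q : nat).
Hypothesis hO : local_valuation_ring pi q.
Variables (d r : nat) (beta : nat -> nat).
Hypotheses (hb0 : beta 0%N = 0%N) (hbr : beta r = d).
Hypothesis hbinc : forall i : nat, (i < r)%N -> (beta i < beta i.+1)%N.
Local Notation T := (Tsp O d r beta).
Local Notation I := (Tidx d r beta).

Lemma MgenB (x y : T) : Mgen (x - y) = Mgen x - Mgen y.
Proof.
by apply/matrixP => a b; rewrite !mxE; case: insub => [p|]; rewrite ?ffunE ?subr0.
Qed.

Lemma Mgen_inj : injective (@Mgen O d r beta).
Proof. by move=> x y e; rewrite -[x]MgenK e MgenK. Qed.

Definition diagI (k : 'I_d) : I := Sub (k, k) (Tpred_refl hb0 hbr hbinc k).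

Lemma Mgen_diagI (x : T) k : Mgen x k k = x (diagI k).
Proof. by rewrite -[RHS]MgenE. Qed.

Definition isdiag (p : I) : bool := (val p).1 == (val p).2.

Lemma isdiagE p : isdiag p -> p = diagI (val p).1.
Proof.
move=> /eqP e; apply: val_inj; rewrite SubK [LHS]surjective_pairing.
by rewrite -e.
Qed.

Definition prodT (h y : T) : T := mkT r beta (Mgen y *m Mgen h).

Lemma Mgen_prodT h y : Mgen (prodT h y) = Mgen y *m Mgen h.
Proof. by rewrite mkTK //; apply: (shaped_mul hb0 hbr hbinc); apply: Mgen_shaped. Qed.

Lemma prodTB h x y : prodT h (x - y) = prodT h x - prodT h y.
Proof. by apply: Mgen_inj; rewrite MgenB !Mgen_prodT MgenB mulmxBl. Qed.

Lemma prodTD h x y : prodT h (x + y) = prodT h x + prodT h y.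
Proof. by have := prodTB h (x + y) y; rewrite addrK => ->; rewrite subrK. Qed.

Lemma prodT_inj h : nondeg h -> injective (prodT h).
Proof.
move=> nd x y /(congr1 (@Mgen O d r beta)); rewrite !Mgen_prodT.
by move/(mulmx_Mgen_inj hb0 hbr hbinc nd)/Mgen_inj.
Qed.

(** Parametrises the points with diagonal in pi O by unrestricted coordinates, the form in which the
    triangular index computation applies. *)
Definition twist (y : I -> O) : T := [ffun p => (if isdiag p then pi else 1) * y p].

Lemma twistB y z : twist (fun p => y p - z p) = twist y - twist z.
Proof. by apply/ffunP => p; rewrite !ffunE mulrBr. Qed.

Definition fibre_group (h : T) : set T := [set x | exists y, x = prodT h (twist y)].

Lemma fibre_group_subgroup h : addsubgroup (fibre_group h).
Proof.
have hB x y : fibre_group h x -> fibre_group h y -> fibre_group h (x - y).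
  by move=> [u ->] [v ->]; exists (fun p => u p - v p); rewrite twistB prodTB.
split=> //; have h1 : fibre_group h (prodT h (twist (fun=> 0))) by exists (fun=> 0).
by rewrite -(subrr (prodT h (twist (fun=> 0)))); apply: hB.
Qed.

Lemma Mgen_twist0 a b : Mgen (twist (fun=> 0)) a b = 0.
Proof. by rewrite mxE; case: insub => // p; rewrite ffunE mulr0. Qed.

(** With the column as rank, y |-> M(twist y) M(h) is triangular; its coefficient at (a, b) is h_bb,
    times pi on the diagonal, which adds 1 to the exponent there. *)
Lemma fibre_group_transversal h : nondeg h ->
  exists (F : finType) (rep : F -> T),
    #|F| = (q ^ (\sum_(p : I) (valO pi (Mgen h (val p).2 (val p).2) + isdiag p)))%N
    /\ transversal (fibre_group h) rep.
Proof.
move=> nd.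
apply: (@triangular_index _ _ (fun p : I => (val p).2 : nat)
  (fun p => Mgen h (val p).2 (val p).2 * (if isdiag p then pi else 1))
  (fun p (u : I -> O) => \sum_(k < d | (k < (val p).2)%N)
     Mgen (twist u) (val p).1 k * Mgen h k (val p).2) _ _
  q (fun p => valO pi (Mgen h (val p).2 (val p).2) + isdiag p)%N
  T (fun v p => v p) (fun u => [ffun p => u p]) (fibre_group h)).
- by move=> p; rewrite mulf_neq0 ?nd //; case: ifP => _; rewrite ?(pi_neq0 hO) ?oner_eq0.
- move=> p y y' e; apply: eq_bigr => k kp; congr (_ * _); rewrite !mxE.
  by case: insubP => // u _ eu; rewrite !ffunE e // eu.
- move=> p; have [F [rep [cF tF]]] := transversal_dvdO hO (nd (val p).2).
  case: ifP => dp; last by exists F, rep; rewrite addn0 mulr1.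
  case: (hO) => _ [rr tr] _; exists (F * 'I_q)%type.
  exists (fun s => rep s.1 + Mgen h (val p).2 (val p).2 * rr s.2); split.
    by rewrite card_prod cF card_ord -expnSr addn1.
  exact: transversal_mul.
- by move=> p; rewrite big1 // => k _; rewrite Mgen_twist0 mul0r.
- by move=> u p; rewrite ffunE.
- by move=> v w p; rewrite !ffunE.
have e (y : I -> O) p : prodT h (twist y) p =
    Mgen h (val p).2 (val p).2 * (if isdiag p then pi else 1) * y p +
    \sum_(k < d | (k < (val p).2)%N) Mgen (twist y) (val p).1 k * Mgen h k (val p).2.
  rewrite ffunE (shaped_mul_entry hb0 hbr hbinc); last exact: Mgen_shaped.
  by rewrite MgenE ffunE mulrC mulrA.
move=> v; split=> [[y ->]|[y hy]]; first by exists y => p; rewrite e.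
by exists y; apply/ffunP => p; rewrite hy e.
Qed.

(** That is, A is a union of balls of one fixed radius; finiteness of the residue rings will make it
    a finite union. *)
Definition stable (A : set T) := exists m, forall x y : T,
  A x -> (forall p, dvdO (pi ^+ m) (y p - x p)) -> A y.

(** The exponent is one more than the valuation of det M(h): if x = pi det M(h) W, then M(x) = (pi
    M(W) adj M(h)) M(h), and the left factor has diagonal in pi O. *)
Lemma fibre_group_absorbs h : nondeg h ->
  exists m, forall x : T, (forall p, dvdO (pi ^+ m) (x p)) -> fibre_group h x.
Proof.
move=> nd; have dh := (nondeg_det hb0 hbr hbinc h).1 nd.
have [u [uu]] := valO_decomp hO dh; move: (valO _ _) => n eu.
exists n.+1 => x hx.
have [w hw] := @fin_all_exists _ (fun=> O) (fun p t => x p = _ * t) hx.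
pose W : T := [ffun p => u^-1 * w p].
have xE : x = [ffun p => pi * \det (Mgen h) * W p].
  apply/ffunP => p; rewrite !ffunE hw eu exprS.
  have -> : pi * (u * pi ^+ n) * (u^-1 * w p) = (u * u^-1) * (pi * pi ^+ n * w p) by ring.
  by rewrite mulrV // mul1r.
pose A := Mgen W *m \adj (Mgen h).
have sA : shaped r beta A.
  apply: (shaped_left hb0 hbr hbinc nd) => a b nab.
  by rewrite -mulmxA mul_adj_mx mul_mx_scalar mxE Mgen_out ?mulr0.
(* [twist] supplies pi on the diagonal only, so elsewhere it is put in by hand; the outcome is pi
   A. *)
exists (fun p => (if isdiag p then 1 else pi) * A (val p).1 (val p).2).
have -> : twist (fun p => (if isdiag p then 1 else pi) * A (val p).1 (val p).2) =
    mkT r beta (pi *: A).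
  by apply/ffunP => p; rewrite !ffunE [RHS]mxE; case: ifP; rewrite !mul1r.
apply/ffunP => p; rewrite ffunE mkTK; last by move=> a b nab; rewrite mxE sA ?mulr0.
by rewrite -scalemxAl mxE -mulmxA mul_adj_mx mul_mx_scalar mxE MgenE xE ffunE mulrA.
Qed.

Lemma coset_stable h a : nondeg h -> stable [set a + x | x in fibre_group h].
Proof.
move=> nd; have [m hm] := fibre_group_absorbs nd; exists m => _ y [x Gx <-] hy.
exists (y - a); last by rewrite addrC subrK.
have -> : y - a = (y - (a + x)) + x by rewrite opprD addrA subrK.
apply: (addsubgroupD (fibre_group_subgroup h)) => //.
by apply: hm => p; have := hy p; rewrite !ffunE.
Qed.

Lemma unit_or_dvdO_pi t : t \is a GRing.unit \/ dvdO pi t.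
Proof.
case: (eqVneq t 0) => [->|t0]; first by right; apply: dvdO0.
have [u [uu ->]] := valO_decomp hO t0; case: (valO _ _) => [|n].
  by left; rewrite expr0 mulr1.
by right; rewrite exprSr mulrA mulrC; apply: dvdO_mulr.
Qed.

(** The multipliers y have diagonal entries with nonzero residues. Each of the (q - 1)^d residue
    vectors gives one coset, represented by a diagonal multiplier. *)
Lemma fibre_cosets h : nondeg h ->
  exists (E : finType) (rho : E -> T), [/\ #|E| = (q.-1 ^ d)%N,
    forall e e', fibre_group h (rho e - rho e') -> e = e' &
    [set x | nondeg x /\ rowspan x = rowspan h] =
      \bigcup_(e in [set: E]) [set rho e + x | x in fibre_group h]].
Proof.
move=> nd; case: (hO) => _ [rr [rinj rsur]] _.
(* [i0] indexes the zero residue class, the one that units avoid. *)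
have [i0 hi0] := rsur 0.
have pi_rr i : dvdO pi (rr i) -> i = i0.
  move=> hi; apply: rinj; apply: dvdOD => //.
  by rewrite -sub0r.
pose diagT (e : {ffun 'I_d -> {i | i != i0}}) : T :=
  [ffun p => if isdiag p then rr (val (e (val p).1)) else 0].
exists {ffun 'I_d -> {i | i != i0}}, (fun e => prodT h (diagT e)); split.
- rewrite card_ffun card_ord card_sig; congr (_ ^ _)%N.
  by rewrite -[in RHS](card_ord q) -(cardC1 i0).
- move=> e e' [y]; rewrite -prodTB => /(prodT_inj nd) ey; apply/ffunP => k.
  apply/val_inj/rinj; exists (y (diagI k)).
  have /ffunP/(_ (diagI k)) := ey; rewrite !ffunE /isdiag /= eqxx; exact.
apply/seteqP; split=> [x /= /(rowspan_eqP hb0 hbr hbinc _ nd)[y uy ->]|].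
  have hk k : exists e : {i | i != i0}, dvdO pi (Mgen y k k - rr (val e)).
    have [i hi] := rsur (Mgen y k k).
    have ii0 : i != i0.
      apply/eqP => ei; apply: (dvdO_pi_unit hO (uy k)).
      rewrite -(subrK (rr i) (Mgen y k k)); apply: dvdOD => //.
      by rewrite ei -[rr i0]opprK; apply: dvdON; rewrite -sub0r.
    by exists (Sub i ii0); rewrite SubK.
  have [e he] := @fin_all_exists _ _ _ hk.
  have [t ht] := @fin_all_exists _ (fun=> O) (fun k t => _ = pi * t) he.
  exists (finfun e) => //; exists (prodT h (y - diagT (finfun e))); last first.
    by rewrite prodTB addrC subrK.
  exists (fun p => if isdiag p then t (val p).1 else y p); congr prodT.
  apply/ffunP => p; rewrite !ffunE; case: ifP => dp; last by rewrite mul1r subr0.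
  by rewrite -ht Mgen_diagI -(isdiagE dp).
move=> x [e _ [_ [y ->] <-]] /=; apply/(rowspan_eqP hb0 hbr hbinc _ nd).
exists (diagT e + twist y); last by rewrite -/(prodT _ _) prodTD.
move=> k; rewrite Mgen_diagI !ffunE /isdiag /= eqxx.
have [//|h1] := unit_or_dvdO_pi (rr (val (e k)) + pi * y (diagI k)).
have /pi_rr/eqP : dvdO pi (rr (val (e k))).
  rewrite -(addrK (pi * y (diagI k)) (rr _)); apply: dvdOB => //; exact: dvdO_mulr.
by rewrite (negbTE (valP (e k))).
Qed.


End Fibres.

(** * Haar measure of the fibres *)

Section HaarMeasure.
Variables (R : realType) (O : idomainType) (pi : O) (q : nat).
Hypothesis hO : local_valuation_ring pi q.
Variables (d r : nat) (beta : nat -> nat).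
Local Notation T := (Tsp O d r beta).
Local Notation I := (Tidx d r beta).
Variable mu : {measure set (Tmeas O d r beta pi) -> \bar R}.
Hypothesis hmu : normalised_haar mu.

Lemma residue_card_gt1 : (1 < q)%N.
Proof.
case: (hO) => _ [rr [rinj rsur]] _.
have [i hi] := rsur 0; have [j hj] := rsur 1.
have ij : i != j.
  apply/eqP => e; apply: (dvdO_piN1 hO).
  rewrite -(subrK (rr j) 1); apply: dvdOD => //.
  by rewrite -e -[rr i]opprK; apply: dvdON; rewrite -sub0r.
rewrite ltnNge; apply/negP => q1; case/negP: ij; apply/eqP/val_inj.
have := ltn_ord i; have := ltn_ord j; case: q q1 i j {hi hj} => [|[|]] //= _ i j.
by rewrite !ltnS !leqn0 => /eqP -> /eqP ->.
Qed.

(** Representatives modulo pi^m give finitely many balls covering T; A is the union of those that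
    meet it. *)
Lemma stable_measurable (A : set T) :
  stable pi A -> measurable (A : set (Tmeas O d r beta pi)).
Proof.
move=> [m hA].
have [F [rep [_ [_ rsur]]]] := transversal_dvdO hO (piX_neq0 hO m).
pose c (z : {ffun I -> F}) : T := [ffun p => rep (z p)].
rewrite (_ : A = \bigcup_(z in [set z | exists2 x, A x & Tball pi (c z) m x]) Tball pi (c z) m).
  apply: fin_bigcup_measurable; first exact: finite_finset.
  by move=> z _; apply: sub_sigma_algebra; exists (c z), m.
apply/seteqP; split=> [x Ax|y [z [x Ax hx] hy]].
  have [z hz] := @fin_all_exists _ (fun=> F) (fun p i => dvdO _ (x p - rep i)) (fun p => rsur (x p)).
  have bx : Tball pi (c (finfun z)) m x by move=> p; rewrite !ffunE.
  by exists (finfun z) => //; exists x.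
apply: (hA _ _ Ax) => p; have := dvdOB (hy p) (hx p).
by rewrite opprB addrA subrK.
Qed.

Lemma haar_cosets (G S : set T) (E : finType) (rho : E -> T) :
  addsubgroup G -> (forall a, stable pi [set a + x | x in G]) ->
  (forall e e', G (rho e - rho e') -> e = e') ->
  S = \bigcup_(e in [set: E]) [set rho e + x | x in G] ->
  mu S = (mu G *+ #|E|)%E.
Proof.
move=> sG stG inj ->.
have mG : measurable (G : set (Tmeas O d r beta pi)).
  have := stable_measurable (stG 0); rewrite (_ : [set _ | _ in _] = G) //.
  by apply/seteqP; split=> [_ [x Gx <-]|x Gx]; rewrite ?add0r //; exists x; rewrite ?add0r.
rewrite measure_fin_bigcup; [|exact: finite_finset| |]; last 2 first.
- apply/trivIsetP => e e' _ _ ee'; apply/seteqP; split=> // _ [[x Gx <-] [y Gy exy]].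
  case/eqP: ee'; apply: inj.
  have -> : rho e - rho e' = y - x by apply/eqP; rewrite subr_eq addrAC [y + _]addrC exy addrK.
  exact: sG.2.
- by move=> e _; apply: stable_measurable.
transitivity (\sum_(e \in [set: E]) mu G)%E.
  by apply: eq_fsbigr => e _; apply: hmu.2.
rewrite (_ : [set: E] = [set` enum E]); last first.
  by apply/seteqP; split=> // e _ /=; rewrite mem_enum.
rewrite -fsbig_seq ?enum_uniq // big_const_seq count_predT -cardE.
by elim: #|E| => // n IH; rewrite iterS IH muleS.
Qed.

(** T has mass 1 and is the disjoint union of [#|F|] translates of G. *)
Lemma haar_subgroup (G : set T) (F : finType) (rep : F -> T) :
  addsubgroup G -> (forall a, stable pi [set a + x | x in G]) ->
  transversal G rep -> mu G = (#|F|%:R^-1)%:E.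
Proof.
move=> sG stG [inj sur].
have : mu setT = (mu G *+ #|F|)%E.
  apply: haar_cosets sG stG inj _; apply/seteqP; split=> // x _.
  by have [i hi] := sur x; exists i => //; exists (x - rep i); rewrite // addrC subrK.
rewrite hmu.1 => h.
have F0 : (0 < #|F|)%N by case: #|F| h => // -[] /eqP; rewrite oner_eq0.
(* An infinite mass of G would make the total mass infinite, F being nonempty. *)
have : mu G \is a fin_num.
  rewrite ge0_fin_numE ?measure_ge0 // ltey; apply/eqP => Goo; move: h.
  by rewrite Goo; case: #|F| F0 => // n _; rewrite enatmul_pinfty.
move=> fG; rewrite -(fineK fG) in h *.
move: h; rewrite -EFin_natmul => -[/esym].
move=> h; congr EFin; apply: (mulIf (x := #|F|%:R)).
  by rewrite pnatr_eq0 -lt0n.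
by rewrite mulr_natr h mulVf // pnatr_eq0 -lt0n.
Qed.

Section FibreMeasure.
Hypotheses (hb0 : beta 0%N = 0%N) (hbr : beta r = d).
Hypothesis hbinc : forall i : nat, (i < r)%N -> (beta i < beta i.+1)%N.
Local Notation block := (block hb0 hbr hbinc).

Lemma sum_Tidx (F : 'I_d * 'I_d -> nat) :
  (\sum_(p : I) F (val p) = \sum_(b < d) \sum_(a < d | Tpred r beta (a, b)) F (a, b))%N.
Proof.
rewrite (exchange_big_dep xpredT) //= (pair_big_dep xpredT) /=.
rewrite [RHS](reindex_omap (val : I -> _) insub) /=; last first.
  by move=> [a b] /= ab; rewrite insubT.
apply: eq_big => [p|p _]; last by rewrite -surjective_pairing.
by rewrite valK eqxx -surjective_pairing (valP p).
Qed.

(** The diagonal contributes d, and column b contributes v b once for each of its n_b entries. *)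
Lemma fibre_exponent (v : 'I_d -> nat) :
  (\sum_(p : I) (v (val p).2 + isdiag p) =
    d + \sum_k v k * (k.+1 - beta (block k)))%N.
Proof.
rewrite big_split /= addnC; congr (_ + _)%N.
  etransitivity; first exact: (sum_Tidx (fun p => p.1 == p.2 : nat)).
  rewrite -[RHS]card_ord -sum1_card.
  apply: eq_bigr => b _; rewrite (bigD1 b) ?(Tpred_refl hb0 hbr hbinc) //= eqxx big1 // => a.
  by case/andP => _ /negbTE ->.
etransitivity; first exact: (sum_Tidx (fun p => v p.2)).
apply: eq_bigr => b _ /=.
by rewrite -(card_Tpred hb0 hbr hbinc) big_distrr /=; apply: eq_bigr => a _; rewrite muln1.
Qed.

Lemma fibre_measurable (h : T) : nondeg h ->
  measurable ([set x | nondeg x /\ rowspan x = rowspan h] : set (Tmeas O d r beta pi)).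
Proof.
move=> nd; have [E [rho [_ _ ->]]] := fibre_cosets hO hb0 hbr hbinc nd.
apply: fin_bigcup_measurable; first exact: finite_finset.
by move=> e _; apply: stable_measurable; apply: (coset_stable hO hb0 hbr hbinc).
Qed.

(** There are (q - 1)^d cosets, each of measure q^(-d) times the product of the q^(-n_k v(h_kk)). *)
Lemma fibre_measure (h : T) : nondeg h ->
  mu [set x | nondeg x /\ rowspan x = rowspan h] =
  ((1 - (q%:R : R)^-1) ^+ d *
    \prod_(k < d) ((q%:R : R) ^- valO pi (Mgen h k k)) ^+ (k.+1 - beta (block k)))%:E.
Proof.
move=> nd; have [E [rho [cE inj eS]]] := fibre_cosets hO hb0 hbr hbinc nd.
have [F [rep [cF tF]]] := fibre_group_transversal hO hb0 hbr hbinc nd.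
have sG := fibre_group_subgroup pi hb0 hbr hbinc h.
have stG a := coset_stable hO hb0 hbr hbinc a nd.
rewrite (haar_cosets sG stG inj eS) (haar_subgroup sG stG tF) cE cF -EFin_natmul.
have /= fe := fibre_exponent (fun k => valO pi (Mgen h k k)).
congr EFin; rewrite fe expnD -[LHS]mulr_natl natrM !natrX invfM.
have q0 : q%:R != 0 :> R by rewrite pnatr_eq0 -lt0n ltnW // residue_card_gt1.
rewrite mulrA; congr (_ * _).
  rewrite -exprVn -exprMn; congr (_ ^+ _).
  by rewrite -subn1 natrB ?mulrBl ?mulfV ?mul1r // ltnW // residue_card_gt1.
rewrite -exprVn -prodrXr; apply: eq_bigr => k _.
by rewrite -exprVn exprM.
Qed.

End FibreMeasure.

End HaarMeasure.

(** * Complex powers of positive reals *)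

Section ComplexPowers.
Variable R : realType.
Implicit Types (a b : R) (z s : R[i]).

Lemma cpowE a z : 0 < a ->
  cpow a z = Complex (a `^ complex.Re z * cos (complex.Im z * ln a))
                     (a `^ complex.Re z * sin (complex.Im z * ln a)).
Proof.
by move=> a0; rewrite /cpow gt_eqF //; congr Complex; rewrite /= mul0r ?subr0 ?addr0.
Qed.

Lemma complex_mulE (x y z t : R) :
  Complex x y * Complex z t = Complex (x * z - y * t) (x * t + y * z).
Proof. by []. Qed.

Lemma cpow0 z : cpow (0 : R) z = 0. Proof. by rewrite /cpow eqxx. Qed.

Lemma cpowM a b z : 0 < a -> 0 < b -> cpow (a * b) z = cpow a z * cpow b z.
Proof.
move=> a0 b0; rewrite !cpowE ?mulr_gt0 // complex_mulE powRM ?ltW // lnM // mulrDr cosD sinD.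
by congr Complex; ring.
Qed.

Lemma cpow1 z : cpow (1 : R) z = 1.
Proof. by rewrite cpowE // powR1 ln1 mulr0 cos0 sin0 mulr0 mulr1. Qed.

Lemma cpow_prod (I : Type) (r : seq I) (a : I -> R) z : (forall i, 0 < a i) ->
  cpow (\prod_(i <- r) a i) z = \prod_(i <- r) cpow (a i) z.
Proof.
move=> a0; elim: r => [|i r IH]; first by rewrite !big_nil cpow1.
by rewrite !big_cons cpowM ?IH // prodr_gt0.
Qed.

Lemma cpowV a z : 0 < a -> cpow a^-1 z = cpow a (- z).
Proof.
move=> a0; case: z => x y; rewrite !cpowE ?invr_gt0 //= lnV ?posrE // -powR_inv1 ?ltW //.
by rewrite -powRrM mulN1r mulrN mulNr.
Qed.

(** The shift contributes a real factor only, so it can later be pulled out of real and imaginary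
    parts. *)
Lemma cpowB_nat a z n : 0 < a -> cpow a (z - n%:R) = cpow a z * Complex (a ^- n) 0.
Proof.
move=> a0; have -> : n%:R = Complex (n%:R : R) 0 :> R[i].
  by elim: n => // n IH; rewrite !mulrS IH; congr Complex; rewrite addr0.
case: z => x y; rewrite !cpowE // complex_mulE /= !subr0 ?oppr0 ?addr0.
have -> : a `^ (x - n%:R) = a `^ x * a ^- n.
  by rewrite powRD ?(gt_eqF a0) ?implybT // powRN powR_mulrn ?ltW.
by congr Complex; ring.
Qed.

End ComplexPowers.

(** * The integrand as a function of the row span *)

Section Integrand.
Variables (R : realType) (O : idomainType) (pi : O) (q : nat).
Hypothesis hO : local_valuation_ring pi q.
Variables (d r : nat) (beta : nat -> nat).
Hypotheses (hb0 : beta 0%N = 0%N) (hbr : beta r = d).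
Hypothesis hbinc : forall i : nat, (i < r)%N -> (beta i < beta i.+1)%N.
Local Notation T := (Tsp O d r beta).
Local Notation block := (block hb0 hbr hbinc).
Variable s : R[i].

Lemma integrandE (x : T) : @integrand R O d r beta pi q s x =
  \prod_(k < d) cpow (absO R pi q (Mgen x k k)) (s - (k.+1 - beta (block k))%:R).
Proof.
(* The factors are extended by 1 beyond d, as [prod_blocks] takes a function on all natural
   numbers. *)
pose G n := if @insub _ (fun k => (k < d)%N) 'I_d n is Some k
  then cpow (absO R pi q (Mgen x k k)) (s - (k.+1 - beta (block k))%:R) else 1.
transitivity (\prod_(k < d) G k); last by apply: eq_bigr => k _; rewrite /G valK.
rewrite -(prod_blocks hb0 hbr hbinc); apply: eq_bigr => i _; apply: eq_bigr => j _.
have ij : inblock beta i (beta i + j).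
  by rewrite /inblock leq_addr -ltn_subRL ltn_ord.
have ijd : (beta i + j < d)%N.
  case/andP: ij => _ ij; apply: leq_trans ij _.
  by rewrite -hbr; apply: (beta_homo hbinc); rewrite ltn_ord leqnn.
rewrite /G /mentry insubT /=.
have -> : block (Sub (beta i + j)%N ijd) = i.
  by apply/eqP; rewrite eq_sym -inblockE.
by rewrite -addnS addKn.
Qed.

(** The conventions |0| = 0 and [cpow 0 z = 0] make a zero diagonal entry kill the product, whatever
    the exponent. *)
Lemma integrand_degenerate (x : T) : ~ nondeg x -> @integrand R O d r beta pi q s x = 0.
Proof.
move=> /existsNP[k /negP/negPn/eqP xk].
by rewrite integrandE (bigD1 k) //= xk /absO eqxx cpow0 mul0r.
Qed.

Let q_gt0 : 0 < q%:R :> R.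
Proof. by rewrite ltr0n ltnW // (residue_card_gt1 hO). Qed.

(** The powers |x_kk|^s multiply to the zeta term of the row span; the shifts by n_k remain as a
    positive real factor. *)
Lemma integrand_nondeg (x : T) : nondeg x -> @integrand R O d r beta pi q s x =
  zeta_term s (rowspan x) *
  Complex (\prod_(k < d) ((q%:R : R) ^- valO pi (Mgen x k k)) ^+ (k.+1 - beta (block k)))^-1 0.
Proof.
move=> nd; rewrite integrandE /zeta_term (rowspan_indexO hO hb0 hbr hbinc nd).
have a0 k : 0 < (q%:R : R) ^- valO pi (Mgen x k k) by rewrite invr_gt0 exprn_gt0.
rewrite -cpowV ?ltr0n ?expn_gt0 -?(ltr0n R) ?q_gt0 // natrX expr_sum -prodfV cpow_prod //.
rewrite -prodfV.
have -> : Complex (\prod_(k < d) ((q%:R : R) ^- valO pi (Mgen x k k)) ^- (k.+1 - beta (block k))) 0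
  = \prod_(k < d) Complex (((q%:R : R) ^- valO pi (Mgen x k k)) ^- (k.+1 - beta (block k))) 0.
  exact: (rmorph_prod (@real_complex R)).
rewrite -big_split; apply: eq_bigr => k _ /=.
by rewrite -cpowB_nat // /absO (negbTE (nd k)).
Qed.

End Integrand.

(** * Sums of positive families and extended real arithmetic *)

Section PositiveSums.
Variable R : realType.

(** The sets where f >= 1/(n + 1) exhaust D, and each is finite since otherwise the sum would be
    infinite. *)
Lemma esum_lt_pinfty_countable (T : choiceType) (D : set T) (f : T -> R) :
  (forall t, D t -> 0 < f t) -> (\esum_(t in D) (f t)%:E < +oo)%E -> countable D.
Proof.
move=> f0 fin.
pose D_ n := [set t | D t /\ n.+1%:R^-1 <= f t].
have -> : D = \bigcup_n D_ n.
  apply/seteqP; split=> [t Dt|t [n _ []] //].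
  have ft := f0 _ Dt; exists (Num.truncn (f t)^-1) => //; split=> //.
  by rewrite invf_ple ?posrE ?ltr0n // ltW // truncnS_gt.
apply: bigcup_countable => // n _; apply: finite_set_countable; apply: contrapT => inf.
move: fin; rewrite ltNge => /negP; apply; rewrite leye_eq; apply/eqP/eqyP => A A0.
(* More than A (n + 1) terms of size at least 1/(n + 1) sum to at least A. *)
have [B BD cB] := infinite_set_fset (Num.truncn (A * n.+1%:R)).+1 inf.
apply: esum_ge; exists [set` B].
  by split; [exact: finite_fset|move=> t /BD []].
apply: (@le_trans _ _ (\sum_(t \in [set` B]) (n.+1%:R^-1)%:E)%E); last first.
  by apply: lee_fsum => [|t /BD[]]; [exact: finite_fset|rewrite lee_fin].
rewrite -fsbig_seq ?fset_uniq // big_const_seq count_predT.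
have -> k (x : R) : iter k (+%E x%:E) 0%E = (x *+ k)%:E.
  by elim: k => // k IH; rewrite iterS IH -EFinD -mulrS.
rewrite lee_fin -[leRHS]mulr_natl ler_pdivlMr ?ltr0n //.
by apply: ltW; apply: (lt_le_trans (truncnS_gt _)); rewrite ler_nat.
Qed.

(** A positive factor preserves infinities, and [fine] sends them to 0, so the infinite cases agree
    as well. *)
Lemma fine_muleB (C : R) (x y : \bar R) : 0 < C ->
  fine (C%:E * x - C%:E * y)%E = C * fine (x - y)%E.
Proof.
move=> C0.
have hy : (C%:E * +oo = +oo)%E by rewrite gt0_muley ?lte_fin.
have hN : (C%:E * -oo = -oo)%E by rewrite gt0_muleNy ?lte_fin.
case: x => [x| |]; case: y => [y| |]; rewrite ?hy ?hN /= ?mulr0 //.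
by rewrite mulrBr.
Qed.

End PositiveSums.

(** * Integration fibre by fibre *)

Section FibreIntegral.
Variables (R : realType) (O : idomainType) (pi : O) (q : nat).
Hypothesis hO : local_valuation_ring pi q.
Variables (d r : nat) (beta : nat -> nat).
Hypotheses (hb0 : beta 0%N = 0%N) (hbr : beta r = d).
Hypothesis hbinc : forall i : nat, (i < r)%N -> (beta i < beta i.+1)%N.
Variable c : 'I_d -> 'I_d -> 'rV[O]_d.
Local Notation T := (Tsp O d r beta).
Local Notation TM := (Tmeas O d r beta pi).
Local Notation D := (gr_subalgebras r beta c).
Local Notation block := (block hb0 hbr hbinc).
Variable mu : {measure set TM -> \bar R}.
Hypothesis hmu : normalised_haar mu.

Definition fibre (U : set 'rV[O]_d) : set T := [set x | nondeg x /\ rowspan x = U].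

Lemma gr_subalgebra_rowspan U : D U -> exists2 h : T, nondeg h & U = rowspan h.
Proof. by case=> -[sU _] hU [n hn]; apply: (hermite_form hO hb0 hbr hbinc sU hU hn). Qed.

(** The fibres cut the nondegenerate part of V into countably many measurable pieces. On each, g is
    constant, and the piece over U contributes C t(U) by hypothesis. *)
Lemma integral_fibres (g : T -> R) (phi t : set 'rV[O]_d -> R) (C : R) :
  countable D ->
  (forall U, 0 <= phi U) -> (forall U, 0 <= t U) ->
  (forall x : T, nondeg x -> g x = phi (rowspan x)) ->
  (forall x : T, ~ nondeg x -> g x = 0) ->
  (forall h : T, nondeg h ->
    (phi (rowspan h))%:E * mu (fibre (rowspan h)) = (C * t (rowspan h))%:E)%E ->
  (\int[mu]_(x in @Vset O d r beta c pi) (g x)%:E = C%:E * \esum_(U in D) (t U)%:E)%E.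
Proof.
move=> /countable_injP[f finj] phi0 t0 gphi gdeg ht.
(* The fibres are numbered through the injection f, to use additivity over sequences; numbers
   outside its image give the empty set. *)
pose F n : set TM := [set x : T | [/\ nondeg x, D (rowspan x) & f (rowspan x) = n]].
have FS U : D U -> F (f U) = fibre U.
  move=> DU; apply/seteqP; split=> x [nd]; first by move=> Dx e; split=> //; apply: finj => //; exact: mem_set.
  by move=> e; split; rewrite ?e.
have mfibre (h : T) : nondeg h -> measurable (fibre (rowspan h) : set TM).
  exact: (fibre_measurable hO hb0 hbr hbinc).
have F0 n : ~ (f @` D) n -> F n = set0.
  by move=> nn; apply/seteqP; split=> // x [nd Dx e]; apply: nn; exists (rowspan x).
have mF n : measurable (F n).
  have [[U DU <-]|/F0 ->] := pselect ((f @` D) n); last exact: measurable0.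
  by rewrite FS //; have [h nd ->] := gr_subalgebra_rowspan DU; apply: mfibre.
have tF : trivIset setT F.
  by apply/trivIsetP => i j _ _ ij; apply/seteqP; split=> // x [[_ _ ei] [_ _ ej]];
    case/eqP: ij; rewrite -ei -ej.
(* Decoding of n; outside the image of f the default [set0] is masked by the condition in [intF]. *)
pose U_ n := xget set0 [set U | D U /\ f U = n].
have U_f U : D U -> U_ (f U) = U.
  by move=> DU; apply: xget_unique => // U' [DU' e]; apply: finj => //; exact: mem_set.
have g0 x : 0 <= g x.
  by have [/gphi ->|/gdeg ->] := pselect (nondeg x).
have gF U x : fibre U x -> g x = phi U by move=> [nd <-]; apply: gphi.
have VF : @Vset O d r beta c pi `&` [set x | nondeg (x : T)] = \bigcup_n F n.
  apply/seteqP; split=> [x [Vx nd]|x [n _ [nd Dx _]]].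
    by exists (f (rowspan x)) => //; split=> //; apply/(rowspan_gr hO hb0 hbr hbinc).
  by split=> //; apply/(rowspan_gr hO hb0 hbr hbinc).
transitivity (\int[mu]_(x in \bigcup_n F n) (g x)%:E)%E.
  rewrite -VF [LHS]integral_mkcond [RHS]integral_mkcond; apply: eq_integral => x _.
  rewrite !patchE; have [nd|nd] := pselect (nondeg (x : T)); last by rewrite gdeg // !if_same.
  by rewrite in_setI [X in _ && X]mem_set // andbT.
rewrite ge0_integral_bigcup //; last 2 first.
- apply/measurable_fun_bigcup => // n.
  have [[U DU <-]|/F0 ->] := pselect ((f @` D) n); last exact: measurable_fun_set0.
  apply: (eq_measurable_fun (cst (phi U)%:E)); last exact: measurable_cst.
  by move=> x /set_mem; rewrite FS // => /gF ->.
- by move=> x _; rewrite lee_fin.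
have intF n : (\int[mu]_(x in F n) (g x)%:E =
    C%:E * (if n \in f @` D then (t (U_ n))%:E else 0))%E.
  case: ifPn => [|/negP]; rewrite in_setE; last first.
    by move=> /F0 ->; rewrite integral_set0 mule0.
  move=> [U DU <-]; rewrite FS // U_f //.
  have [h nd eU] := gr_subalgebra_rowspan DU.
  rewrite (eq_integral (cst (phi U)%:E)); last by move=> x /set_mem /gF ->.
  rewrite integral_cst; last by rewrite eU; apply: mfibre.
  by rewrite eU ht // EFinM.
under eq_eseriesr do rewrite intF.
have t0' n : (0 <= if n \in f @` D then (t (U_ n))%:E else 0 :> \bar R)%E.
  by case: ifP => // _; rewrite lee_fin.
rewrite nneseriesZl; last by move=> n _; exact: t0'.
(* The series over numbers is reindexed along f as a sum over D. *)
congr (_ * _)%E; rewrite nneseries_esumT // -esum_mkcond.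
rewrite (@reindex_esum R _ _ D (f @` D) f); last by split=> // U V /finj; apply.
by apply: eq_esum => U DU; rewrite U_f.
Qed.

End FibreIntegral.

(** * Recombination of signed real and imaginary parts into the zeta integral *)

Theorem mainTheorem1 (R : realType) (O : idomainType) (pi : O) (q : nat)
  (hO : local_valuation_ring pi q)
  (d r : nat) (beta : nat -> nat)
  (hb0 : beta 0%N = 0%N) (hbr : beta r = d)
  (hbinc : forall i : nat, (i < r)%N -> (beta i < beta i.+1)%N)
  (c : 'I_d -> 'I_d -> 'rV[O]_d)
  (mu : {measure set (Tmeas O d r beta pi) -> \bar R})
  (hmu : normalised_haar mu)
  (s : R[i])
  (hzeta : @zeta_converges R O d r beta c s)
  (hintRe : mu.-integrable (@Vset O d r beta c pi)
              (fun x => (complex.Re (@integrand R O d r beta pi q s x))%:E))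
  (hintIm : mu.-integrable (@Vset O d r beta c pi)
              (fun x => (complex.Im (@integrand R O d r beta pi q s x))%:E)) :
  @zeta_gr R O d r beta c s =
    Complex ((1 - (q%:R : R)^-1) ^- d) 0 *
    cintegral mu (@Vset O d r beta c pi) (@integrand R O d r beta pi q s).
Proof.
have q1 := residue_card_gt1 hO.
(* Convergence of a sum of positive terms leaves only countably many subalgebras. *)
have cD : countable (gr_subalgebras r beta c).
  apply: esum_lt_pinfty_countable hzeta => U DU.
  have [h nd ->] := gr_subalgebra_rowspan hO hb0 hbr hbinc DU.
  by rewrite powR_gt0 // (rowspan_indexO hO hb0 hbr hbinc nd) ltr0n expn_gt0 ltnW.
have C0 : 0 < (1 - (q%:R : R)^-1) ^+ d.
  by rewrite exprn_gt0 // subr_gt0 invf_lt1 ?ltr1n // ltr0n ltnW.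
set C := (1 - _) ^+ d in C0 *.
(* For U the row span of h this is the product of the |h_kk|^(-n_k); written through the measure of
   the fibre, it visibly depends on U alone. *)
pose k U : R := C / fine (mu (fibre (beta := beta) (r := r) U)).
have muE (h : Tsp O d r beta) : nondeg h -> exists2 w : R, 0 < w &
    mu (fibre (rowspan h)) = (C * w)%:E /\
    @integrand R O d r beta pi q s h = zeta_term s (rowspan h) * Complex w^-1 0.
  move=> nd; eexists; last first.
    split; last exact: (integrand_nondeg hO hb0 hbr hbinc).
    exact: (fibre_measure hO hmu hb0 hbr hbinc nd).
  by apply: prodr_gt0 => j _; rewrite exprn_gt0 // invr_gt0 exprn_gt0 // ltr0n ltnW.
(* Nonnegative case: p commutes with nonnegative real factors, so p of the integrand is p of the
   zeta term times [k U]. *)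
have part (p : R[i] -> R) : (forall z (w : R), 0 <= w -> p (z * Complex w 0) = p z * w) ->
    (forall z, 0 <= p z) -> p 0 = 0 ->
    (\int[mu]_(x in @Vset O d r beta c pi) (p (@integrand R O d r beta pi q s x))%:E =
     C%:E * \esum_(U in gr_subalgebras r beta c) (p (zeta_term s U))%:E)%E.
  move=> pM p0 p00.
  have k0 U : 0 <= k U by rewrite divr_ge0 ?fine_ge0 // ltW.
  apply: (integral_fibres hO hb0 hbr hbinc (phi := fun U => p (zeta_term s U) * k U)) => //.
  - by move=> U; rewrite mulr_ge0.
  - move=> x nd; have [w w0 [mw ->]] := muE x nd.
    rewrite pM ?invr_ge0 ?ltW //; congr (_ * _).
    by rewrite /k mw /= invfM mulrA mulfV ?mul1r ?gt_eqF.
  - by move=> x /(@integrand_degenerate R O pi q d r beta hb0 hbr hbinc s) ->.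
  - move=> h nd; have [w w0 [mw _]] := muE h nd.
    rewrite /k mw -EFinM /=; congr EFin.
    by rewrite -mulrA divfK 1?mulrC ?mulf_neq0 ?gt_eqF.
(* A signed p is split into positive and negative parts, to each of which the nonnegative case
   applies. *)
have partRI (p : R[i] -> R) : (forall z (w : R), p (z * Complex w 0) = p z * w) -> p 0 = 0 ->
    fine (\int[mu]_(x in @Vset O d r beta c pi) (p (@integrand R O d r beta pi q s x))%:E)%E =
     C * fine (esum_signed (gr_subalgebras r beta c) (fun U => p (zeta_term s U))).
  move=> pM p00; rewrite integralE /esum_signed -fine_muleB //; congr fine.
  have maxM (u w : R) : 0 <= w -> Num.max (u * w) 0 = Num.max u 0 * w.
    by move=> w0; rewrite maxr_pMl // mul0r.
  congr (_ - _)%E.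
    transitivity (\int[mu]_(x in @Vset O d r beta c pi)
        (Num.max (p (@integrand R O d r beta pi q s x)) 0)%:E)%E.
      by apply: eq_integral => x _; rewrite funeposE EFin_max.
    rewrite (part (fun z => Num.max (p z) 0)) ?p00 ?maxxx //.
    - by congr (_ * _)%E; apply: eq_esum => U _; rewrite funeposE EFin_max.
    - by move=> z w w0; rewrite pM maxM.
    - by move=> z; rewrite le_max lexx orbT.
  transitivity (\int[mu]_(x in @Vset O d r beta c pi)
      (Num.max (- p (@integrand R O d r beta pi q s x)) 0)%:E)%E.
    by apply: eq_integral => x _; rewrite funenegE EFin_max.
  rewrite (part (fun z => Num.max (- p z) 0)) ?p00 ?oppr0 ?maxxx //.
  - by congr (_ * _)%E; apply: eq_esum => U _; rewrite funenegE EFin_max.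
  - by move=> z w w0; rewrite pM -mulNr maxM.
  - by move=> z; rewrite le_max lexx orbT.
(* Both parts of the integral carry the factor C, which the prefactor cancels. *)
rewrite /zeta_gr /csum /cintegral (partRI (@complex.Re R)) ?(partRI (@complex.Im R)) //;
  try by move=> [x y] w /=; rewrite mulr0 ?subr0 ?add0r.
rewrite complex_mulE !mul0r subr0 addr0 !mulrA mulVf ?gt_eqF //.
by rewrite !mul1r.
Qed.
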